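(* Let $0<R_1<R_2$, $L>0$, $h(\theta)=c(1+\epsilon\cos\theta)$ with $c>0$, $0<\epsilon<1$, and let $k_1,k_2,k_3$ be the positive constants given in the context. Then the porous journal bearing problem without cavitation has one and only one weak solution: there exists a unique $u\in H^1_{00}(Q)$ such that $$a(u,v)=\langle f,v\rangle\qquad\text{for all } v\in H^1_{00}(Q),$$ where $H^1_{00}(Q)$, $a$ and $f$ are as defined in the context.
   Context: Cylindrical coordinates $(\rho,\theta,y)$ are used; $Q=\{R_1<\rho<R_2,\ 0<\theta\le2\pi,\ 0<y<L\}$. The constants are $k_1=\frac{c^2}{12\Phi R_2^2}$, $k_2=\frac{c^2}{12L^2\Phi}$, $k_3=\frac{6U\mu}{12\Phi R_2}$ with $\Phi,U,\mu>0$ given constants. Let $\mathcal H$ be the set of $C^\infty$ functions $v(\rho,\theta,y)$ on $\bar Q$, $2\pi$-periodic in $\theta$ (i.e. smooth on $[R_1,R_2]\times\mathbb R\times[0,L]$ and $2\pi$-periodic in $\theta$), taking arbitrary values on $C_2=\{\rho=R_2,\ 0<y<L\}$ and vanishing in a neighbourhood of the remaining part of the boundary, i.e. near $\rho=R_1$, $y=0$ and $y=L$. $H^1_{00}(Q)$ is the completion of $\mathcal H$ with respect to the norm $$\|v\|=\Big\{\int_0^{2\pi}\!\int_{R_1}^{R_2}\!\int_0^L\Big[v_\rho^2+\tfrac1{\rho^2}v_\theta^2+v_y^2\Big]\rho\,dy\,d\rho\,d\theta+\int_0^{2\pi}\!\int_0^L\big[k_1v_\theta^2(R_2,\theta,y)+k_2v_y^2(R_2,\theta,y)\big]R_2\,dy\,d\theta\Big\}^{1/2}.$$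 The bilinear form and the functional (given here for $u,v\in\mathcal H$ and extended by continuity to $H^1_{00}(Q)$) are $$a(u,v)=\int_0^{2\pi}\!\int_{R_1}^{R_2}\!\int_0^L\Big[u_\rho v_\rho+\tfrac1{\rho^2}u_\theta v_\theta+u_yv_y\Big]\rho\,dy\,d\rho\,d\theta+\int_0^{2\pi}\!\int_0^Lh^3(\theta)\big[k_1u_\theta v_\theta+k_2u_yv_y\big](R_2,\theta,y)\,R_2\,dy\,d\theta,$$ $$\langle f,v\rangle=\int_0^{2\pi}\!\int_0^Lk_3h'(\theta)v(R_2,\theta,y)\,R_2\,dy\,d\theta.$$ This is the weak form of the problem: $\Delta p=0$ in $Q$; $k_1[h^3p_\theta]_\theta+k_2[h^3p_y]_y=p_\rho-k_3h'$ on $\rho=R_2$; $p=0$ on $\rho=R_1$, $y=0$, $y=L$; $p$ is $2\pi$-periodic in $\theta$. *)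

(* Defs.v *)
(* Standard-library reals with Coquelicot. *)
From Stdlib Require Import Reals ClassicalEpsilon.
From Coquelicot Require Import Coquelicot.
Open Scope R_scope.

(* A point (rho, theta, y); the angle theta ranges over the whole real line and
   functions on the closure of Q are the 2 pi-periodic ones. *)
Definition point : Type := (R * R * R)%type.

Definition Qbar (R1 R2 L : R) (p : point) : Prop :=
  let '(rho, _, y) := p in R1 <= rho <= R2 /\ 0 <= y <= L.

(* Partial derivatives relative to Qbar: one-sided on its faces. *)
Definition partials_on (R1 R2 L : R) (v v_rho v_theta v_y : point -> R) : Prop :=
  forall rho theta y : R, Qbar R1 R2 L (rho, theta, y) ->
    D_in (fun r => v (r, theta, y)) (fun r => v_rho (r, theta, y))
         (fun r => R1 <= r <= R2) rho /\
    is_derive (fun t => v (rho, t, y)) theta (v_theta (rho, theta, y)) /\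
    D_in (fun z => v (rho, theta, z)) (fun z => v_y (rho, theta, z))
         (fun z => 0 <= z <= L) y.

Fixpoint Cn_on (R1 R2 L : R) (n : nat) (v : point -> R) : Prop :=
  continuous_on (Qbar R1 R2 L) v /\
  match n with
  | O => True
  | S m => exists v_rho v_theta v_y : point -> R,
      partials_on R1 R2 L v v_rho v_theta v_y /\
      Cn_on R1 R2 L m v_rho /\ Cn_on R1 R2 L m v_theta /\ Cn_on R1 R2 L m v_y
  end.

Definition smooth_on (R1 R2 L : R) (v : point -> R) : Prop :=
  forall n : nat, Cn_on R1 R2 L n v.

(* The values of v off Qbar are irrelevant: functions that agree on Qbar are at
   distance 0 for [energy_norm], hence are identified in the completion. *)
Definition test_function (R1 R2 L : R) (v : point -> R) : Prop :=
  smooth_on R1 R2 L v /\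
  (forall rho theta y : R, Qbar R1 R2 L (rho, theta, y) ->
     v (rho, theta + 2 * PI, y) = v (rho, theta, y)) /\
  (forall rho theta y : R, Qbar R1 R2 L (rho, theta, y) ->
     rho = R1 \/ y = 0 \/ y = L ->
     within (Qbar R1 R2 L) (locally (rho, theta, y)) (fun q => v q = 0)).

(* Two-sided derivatives. They are used only under integrals, where the faces on
   which a derivative across the face is not determined by the values on Qbar
   are negligible; on rho = R2 only the tangential ones are integrated. *)
Definition D_rho (v : point -> R) (p : point) : R :=
  let '(rho, theta, y) := p in Derive (fun r => v (r, theta, y)) rho.
Definition D_theta (v : point -> R) (p : point) : R :=
  let '(rho, theta, y) := p in Derive (fun t => v (rho, t, y)) theta.
Definition D_y (v : point -> R) (p : point) : R :=
  let '(rho, theta, y) := p in Derive (fun z => v (rho, theta, z)) y.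

Definition int_Q (R1 R2 L : R) (g : R -> R -> R -> R) : R :=
  RInt (fun theta => RInt (fun rho => RInt (fun y => g rho theta y) 0 L) R1 R2)
       0 (2 * PI).

Definition int_C2 (L : R) (g : R -> R -> R) : R :=
  RInt (fun theta => RInt (fun y => g theta y) 0 L) 0 (2 * PI).

Definition energy_norm (R1 R2 L k1 k2 : R) (v : point -> R) : R :=
  sqrt (int_Q R1 R2 L (fun rho theta y =>
          ((D_rho v (rho, theta, y)) ^ 2
           + 1 / rho ^ 2 * (D_theta v (rho, theta, y)) ^ 2
           + (D_y v (rho, theta, y)) ^ 2) * rho)
        + int_C2 L (fun theta y =>
          (k1 * (D_theta v (R2, theta, y)) ^ 2
           + k2 * (D_y v (R2, theta, y)) ^ 2) * R2)).

Definition bilinear_form (R1 R2 L k1 k2 : R) (h : R -> R) (u v : point -> R) : R :=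
  int_Q R1 R2 L (fun rho theta y =>
    (D_rho u (rho, theta, y) * D_rho v (rho, theta, y)
     + 1 / rho ^ 2 * (D_theta u (rho, theta, y) * D_theta v (rho, theta, y))
     + D_y u (rho, theta, y) * D_y v (rho, theta, y)) * rho)
  + int_C2 L (fun theta y =>
    h theta ^ 3 * (k1 * (D_theta u (R2, theta, y) * D_theta v (R2, theta, y))
                   + k2 * (D_y u (R2, theta, y) * D_y v (R2, theta, y))) * R2).

Definition load (R2 L k3 : R) (h : R -> R) (v : point -> R) : R :=
  int_C2 L (fun theta y => k3 * Derive h theta * v (R2, theta, y) * R2).

(* Completion of a space A of real functions for a (semi)norm N: classes of
   N-Cauchy sequences in A modulo N-null sequences. *)
Definition cauchy_seq {T : Type} (A : (T -> R) -> Prop) (N : (T -> R) -> R)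
    (u : nat -> T -> R) : Prop :=
  (forall n, A (u n)) /\
  forall e : R, 0 < e -> exists M : nat, forall m n : nat,
    (M <= m)%nat -> (M <= n)%nat -> N (fun x => u m x - u n x) < e.

Definition same_limit {T : Type} (N : (T -> R) -> R) (u w : nat -> T -> R) : Prop :=
  is_lim_seq (fun n => N (fun x => u n x - w n x)) 0.

Definition completion {T : Type} (A : (T -> R) -> Prop) (N : (T -> R) -> R) : Type :=
  { K : (nat -> T -> R) -> Prop |
    exists u, cauchy_seq A N u /\
      forall w, K w <-> cauchy_seq A N w /\ same_limit N u w }.

Definition represents {T : Type} {A : (T -> R) -> Prop} {N : (T -> R) -> R}
    (u : nat -> T -> R) (U : completion A N) : Prop :=
  proj1_sig U u.

(* Extension by continuity: the common limit along all representing sequences.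
   [epsilon] picks an arbitrary real if there is no such limit, which does not
   happen for N-bounded forms such as [load] and [bilinear_form]. *)
Definition extend1 {T : Type} {A : (T -> R) -> Prop} {N : (T -> R) -> R}
    (F : (T -> R) -> R) (V : completion A N) : R :=
  epsilon (inhabits 0) (fun l : R =>
    forall v, represents v V -> is_lim_seq (fun n => F (v n)) l).

Definition extend2 {T : Type} {A : (T -> R) -> Prop} {N : (T -> R) -> R}
    (B : (T -> R) -> (T -> R) -> R) (U V : completion A N) : R :=
  epsilon (inhabits 0) (fun l : R =>
    forall u v, represents u U -> represents v V ->
      is_lim_seq (fun n => B (u n) (v n)) l).

Definition H1_00 (R1 R2 L k1 k2 : R) : Type :=
  completion (test_function R1 R2 L) (energy_norm R1 R2 L k1 k2).

Definition film_thickness (c eps theta : R) : R := c * (1 + eps * cos theta).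

Definition coef1 (c Phi R2 : R) : R := c ^ 2 / (12 * Phi * R2 ^ 2).
Definition coef2 (c Phi L : R) : R := c ^ 2 / (12 * L ^ 2 * Phi).
Definition coef3 (U mu Phi R2 : R) : R := 6 * U * mu / (12 * Phi * R2).

(* Main.v *)
Require Import Defs.
From Stdlib Require Import Reals Lra Lia Psatz Classical ClassicalEpsilon.
From Stdlib Require Import FunctionalExtensionality PropExtensionality ProofIrrelevance.
From Coquelicot Require Import Coquelicot.
Open Scope R_scope.

(* The form a is symmetric and, since c (1 - eps) <= h <= c (1 + eps), its quadratic form
   is equivalent to the square of the energy norm. Hence the solution is the limit of a
   sequence of test functions maximizing 2 <f, v> - a (v, v): the parallelogram law makes
   the sequence Cauchy and the first variation gives the weak equation, so no Hilbert space
   theory on the completion is needed. Boundedness of f follows from integration by parts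
   in y on C2: as v vanishes at y = 0, the integral of v is that of (L - y) v_y, which
   is controlled by the tangential part of the energy. *)

(** * Semidefinite forms *)

(** Two obstacles shape the proof. Elements of the completion are sets of Cauchy sequences, and
    [extend1] and [extend2] are limits selected by [epsilon]. So every argument is run on sequences
    of test functions and then passed to the limit, and boundedness of the forms is what shows that
    the selected limits are genuine. Semidefinite forms are the right abstraction: the energy does
    not see values off [Qbar], and the quotient by null sequences absorbs its kernel.

    The integrals are built from the total operators [RInt] and [Derive], which return arbitrary
    values where the integral or the derivative does not exist. Linearity and positivity are
    therefore proved for integrands that agree in the interior with a function continuous
    everywhere, and such functions are obtained by composing with a retraction onto [Qbar]. *)

Record subspace {T : Type} (A : (T -> R) -> Prop) : Prop := {
  subspace_zero : A (fun _ => 0);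
  subspace_comb : forall a b u w, A u -> A w -> A (fun x => a * u x + b * w x) }.

Record linear_form {T : Type} (A : (T -> R) -> Prop) (F : (T -> R) -> R) : Prop := {
  linear_form_comb : forall a b u w, A u -> A w ->
    F (fun x => a * u x + b * w x) = a * F u + b * F w }.

(** All laws are relative to [A]: the concrete forms are linear only on test functions, where the
    integrals exist. Linearity in the second argument follows from symmetry. *)
Record psd_form {T : Type} (A : (T -> R) -> Prop)
    (B : (T -> R) -> (T -> R) -> R) : Prop := {
  psd_comb_l : forall a b u w z, A u -> A w -> A z ->
    B (fun x => a * u x + b * w x) z = a * B u z + b * B w z;
  psd_sym : forall u w, A u -> A w -> B u w = B w u;
  psd_nonneg : forall u, A u -> 0 <= B u u }.

(** Evaluation at the vertex gives the bound when p > 0. It is used three times: for Cauchy-Schwarz,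
    for the norm bound on the linear form, and for the first variation. The case p = 0 matters
    because the forms are only semidefinite. *)
Lemma nonneg_quadratic_discriminant (p q r : R) :
  0 <= p -> (forall t, 0 <= p * t ^ 2 + 2 * q * t + r) -> q ^ 2 <= p * r.
Proof.
  intros hp H.
  destruct (Req_dec p 0) as [-> | hp0].
  - destruct (Req_dec q 0) as [-> | hq]; [lra | exfalso].
    (* With p = 0 the polynomial is affine with nonzero slope, and this argument makes its value
       -1. *)
    specialize (H (- (r + 1) / (2 * q))).
    replace (0 * (- (r + 1) / (2 * q)) ^ 2 + 2 * q * (- (r + 1) / (2 * q)) + r)
      with (-1) in H by (field; lra).
    lra.
  - specialize (H (- q / p)).
    replace (p * (- q / p) ^ 2 + 2 * q * (- q / p) + r)
      with ((p * r - q ^ 2) / p) in H by (field; lra).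
    apply Rmult_le_compat_r with (r := p) in H; [| lra].
    replace ((p * r - q ^ 2) / p * p) with (p * r - q ^ 2) in H by (field; lra).
    lra.
Qed.

Lemma sub_as_comb {T : Type} (u w : T -> R) :
  (fun x => u x - w x) = (fun x => 1 * u x + (-1) * w x).
Proof. apply functional_extensionality; intro x; ring. Qed.

Lemma subspace_sub {T : Type} (A : (T -> R) -> Prop) (u w : T -> R) :
  subspace A -> A u -> A w -> A (fun x => u x - w x).
Proof. intros [_ h] hu hw. rewrite sub_as_comb. now apply h. Qed.

Section PsdForm.
Context {T : Type} {A : (T -> R) -> Prop} {B : (T -> R) -> (T -> R) -> R}.
Context (hA : subspace A) (hB : psd_form A B).

Lemma psd_comb_r (a b : R) (z u w : T -> R) : A z -> A u -> A w ->
  B z (fun x => a * u x + b * w x) = a * B z u + b * B z w.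
Proof.
  intros hz hu hw.
  rewrite (psd_sym _ _ hB) by (try apply hA; assumption).
  rewrite (psd_comb_l _ _ hB) by assumption.
  now rewrite (psd_sym _ _ hB u), (psd_sym _ _ hB w).
Qed.

Lemma psd_comb_diag (a b : R) (u w : T -> R) : A u -> A w ->
  B (fun x => a * u x + b * w x) (fun x => a * u x + b * w x)
  = a ^ 2 * B u u + 2 * a * b * B u w + b ^ 2 * B w w.
Proof.
  intros hu hw.
  rewrite (psd_comb_l _ _ hB) by (try apply hA; assumption).
  rewrite !psd_comb_r by assumption.
  rewrite (psd_sym _ _ hB w u) by assumption. ring.
Qed.

Lemma psd_cauchy_schwarz (u w : T -> R) : A u -> A w ->
  (B u w) ^ 2 <= B u u * B w w.
Proof.
  intros hu hw. rewrite Rmult_comm.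
  apply nonneg_quadratic_discriminant; [now apply hB |].
  intro t.
  assert (h := psd_nonneg _ _ hB _ (subspace_comb _ hA 1 t u w hu hw)).
  rewrite psd_comb_diag in h by assumption. lra.
Qed.

Lemma psd_cauchy_schwarz_sqrt (u w : T -> R) : A u -> A w ->
  Rabs (B u w) <= sqrt (B u u) * sqrt (B w w).
Proof.
  intros hu hw.
  rewrite <- sqrt_mult by now apply hB.
  rewrite <- (sqrt_Rsqr_abs (B u w)).
  apply sqrt_le_1_alt. rewrite Rsqr_pow2. now apply psd_cauchy_schwarz.
Qed.

(** Both sides are squared and the cross term is bounded by Cauchy-Schwarz. Homogeneity and the
    triangle inequality are kept in one statement, from which the seminorm laws on sequences are
    read off. *)
Lemma psd_seminorm_comb (a b : R) (u w : T -> R) : A u -> A w ->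
  sqrt (B (fun x => a * u x + b * w x) (fun x => a * u x + b * w x))
  <= Rabs a * sqrt (B u u) + Rabs b * sqrt (B w w).
Proof.
  intros hu hw.
  assert (hc := psd_cauchy_schwarz_sqrt u w hu hw).
  assert (hsu := sqrt_pos (B u u)). assert (hsw := sqrt_pos (B w w)).
  assert (ha := Rabs_pos a). assert (hb := Rabs_pos b).
  rewrite <- (sqrt_pow2 (_ + _)) by nra.
  apply sqrt_le_1_alt.
  rewrite psd_comb_diag by assumption.
  rewrite <- (pow2_sqrt (B u u)) at 1 by now apply hB.
  rewrite <- (pow2_sqrt (B w w)) at 1 by now apply hB.
  rewrite <- (pow2_abs a), <- (pow2_abs b).
  assert (h : a * b * B u w
              <= Rabs a * Rabs b * (sqrt (B u u) * sqrt (B w w))).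
  { apply Rle_trans with (1 := Rle_abs _). rewrite !Rabs_mult.
    apply Rmult_le_compat_l; [nra | assumption]. }
  lra.
Qed.
End PsdForm.

(** * Completions and extension by continuity *)

Lemma represents_cauchy {T : Type} {A : (T -> R) -> Prop} {N : (T -> R) -> R}
    (u : nat -> T -> R) (U : completion A N) :
  represents u U -> cauchy_seq A N u.
Proof.
  destruct U as [K [u0 [h0 hK]]]; unfold represents; simpl.
  intro hu. now apply hK in hu.
Qed.

Section Completion.
Context {T : Type} {A : (T -> R) -> Prop} {E : (T -> R) -> (T -> R) -> R}.
Context {N : (T -> R) -> R}.
Context (hA : subspace A) (hE : psd_form A E).
Context (hN : forall u, A u -> N u = sqrt (E u u)).

Lemma seminorm_nonneg (u : T -> R) : A u -> 0 <= N u.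
Proof. intro hu. rewrite hN by assumption. apply sqrt_pos. Qed.

Lemma seminorm_comb (a b : R) (u w : T -> R) : A u -> A w ->
  N (fun x => a * u x + b * w x) <= Rabs a * N u + Rabs b * N w.
Proof.
  intros hu hw. rewrite !hN by (try apply hA; assumption).
  now apply (psd_seminorm_comb hA hE).
Qed.

Lemma seminorm_sub_sym (u w : T -> R) : A u -> A w ->
  N (fun x => u x - w x) = N (fun x => w x - u x).
Proof.
  assert (h : forall u w, A u -> A w ->
            N (fun x => u x - w x) <= N (fun x => w x - u x)).
  { intros u' w' hu hw.
    (* A single multiple is given the two-term shape of [seminorm_comb] by adding a zero
       multiple. *)
    replace (fun x => u' x - w' x)
      with (fun x => (-1) * (w' x - u' x) + 0 * (w' x - u' x))
      by (apply functional_extensionality; intro; ring).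
    eapply Rle_trans; [apply seminorm_comb; now apply (subspace_sub A) |].
    rewrite Rabs_R0, Rabs_left by lra. lra. }
  intros hu hw. apply Rle_antisym; now apply h.
Qed.

Lemma seminorm_add (u w : T -> R) : A u -> A w ->
  N (fun x => u x + w x) <= N u + N w.
Proof.
  intros hu hw.
  replace (fun x => u x + w x) with (fun x => 1 * u x + 1 * w x)
    by (apply functional_extensionality; intro; ring).
  eapply Rle_trans; [now apply seminorm_comb |]. rewrite Rabs_R1. lra.
Qed.

Lemma seminorm_triangle (u w z : T -> R) : A u -> A w -> A z ->
  N (fun x => u x - z x) <= N (fun x => u x - w x) + N (fun x => w x - z x).
Proof.
  intros hu hw hz.
  replace (fun x => u x - z x) with (fun x => (u x - w x) + (w x - z x))
    by (apply functional_extensionality; intro; ring).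
  apply seminorm_add; now apply (subspace_sub A).
Qed.

Lemma seminorm_le_sub (u w : T -> R) : A u -> A w ->
  N u <= N w + N (fun x => u x - w x).
Proof.
  intros hu hw.
  replace u with (fun x => w x + (u x - w x)) at 1
    by (apply functional_extensionality; intro; ring).
  apply seminorm_add; try apply (subspace_sub A); assumption.
Qed.

Lemma cauchy_seq_bounded (u : nat -> T -> R) :
  cauchy_seq A N u -> exists K, 0 < K /\ eventually (fun n => N (u n) <= K).
Proof.
  intros [hu hc]. destruct (hc 1 Rlt_0_1) as [M hM].
  exists (N (u M) + 1). split.
  - assert (h := seminorm_nonneg _ (hu M)). lra.
  - exists M. intros n hn.
    eapply Rle_trans; [apply (seminorm_le_sub (u n) (u M)); apply hu |].
    specialize (hM n M hn (Nat.le_refl M)). lra.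
Qed.

Lemma cauchy_seq_sub (u w : nat -> T -> R) :
  cauchy_seq A N u -> cauchy_seq A N w ->
  cauchy_seq A N (fun n x => u n x - w n x).
Proof.
  intros [hu hcu] [hw hcw]. split.
  - intro n. now apply (subspace_sub A).
  - intros e he.
    destruct (hcu (e / 2)) as [M1 h1]; [lra |].
    destruct (hcw (e / 2)) as [M2 h2]; [lra |].
    exists (Nat.max M1 M2). intros m n hm hn.
    specialize (h1 m n ltac:(lia) ltac:(lia)).
    specialize (h2 m n ltac:(lia) ltac:(lia)).
    replace (fun x => u m x - w m x - (u n x - w n x))
      with (fun x => (u m x - u n x) - (w m x - w n x))
      by (apply functional_extensionality; intro; ring).
    rewrite sub_as_comb.
    eapply Rle_lt_trans; [apply seminorm_comb; now apply (subspace_sub A) |].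
    rewrite Rabs_R1, Rabs_left by lra. lra.
Qed.

Lemma same_limit_refl (u : nat -> T -> R) : cauchy_seq A N u -> same_limit N u u.
Proof.
  intros [hu _]. unfold same_limit.
  apply is_lim_seq_ext with (fun _ => 0); [| apply is_lim_seq_const].
  intro n.
  apply Rle_antisym.
  - now apply seminorm_nonneg, (subspace_sub A).
  - replace (fun x => u n x - u n x) with (fun x => 0 * u n x + 0 * u n x)
      by (apply functional_extensionality; intro; ring).
    eapply Rle_trans; [now apply seminorm_comb |]. rewrite Rabs_R0. lra.
Qed.

Lemma same_limit_sym (u w : nat -> T -> R) : cauchy_seq A N u -> cauchy_seq A N w ->
  same_limit N u w -> same_limit N w u.
Proof.
  intros [hu _] [hw _]. apply is_lim_seq_ext.
  intro n. now apply seminorm_sub_sym.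
Qed.

Lemma same_limit_trans (u w z : nat -> T -> R) :
  cauchy_seq A N u -> cauchy_seq A N w -> cauchy_seq A N z ->
  same_limit N u w -> same_limit N w z -> same_limit N u z.
Proof.
  intros [hu _] [hw _] [hz _] h1 h2.
  apply is_lim_seq_le_le with (fun _ => 0)
    (fun n => N (fun x => u n x - w n x) + N (fun x => w n x - z n x)).
  - intro n. split.
    + now apply seminorm_nonneg, (subspace_sub A).
    + now apply seminorm_triangle.
  - apply is_lim_seq_const.
  - replace (Finite 0) with (Finite (0 + 0)) by (f_equal; ring).
    now apply is_lim_seq_plus'.
Qed.

Lemma represents_same_limit (u w : nat -> T -> R) (U : completion A N) :
  represents u U -> represents w U -> same_limit N u w.
Proof.
  intros hu hw.
  assert (hcu := represents_cauchy _ _ hu). assert (hcw := represents_cauchy _ _ hw).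
  destruct U as [K [u0 [h0 hK]]]; unfold represents in hu, hw; simpl in hu, hw.
  apply hK in hu. apply hK in hw.
  apply same_limit_trans with u0; try tauto. now apply same_limit_sym.
Qed.

Lemma represents_exists (U : completion A N) : exists u, represents u U.
Proof.
  destruct U as [K [u0 [h0 hK]]]; unfold represents; simpl.
  exists u0. apply hK. split; [assumption |]. now apply same_limit_refl.
Qed.

Lemma completion_class (u : nat -> T -> R) : cauchy_seq A N u ->
  exists U : completion A N, represents u U.
Proof.
  intro hu.
  assert (h : exists v, cauchy_seq A N v /\ forall w,
            (cauchy_seq A N w /\ same_limit N u w)
            <-> cauchy_seq A N w /\ same_limit N v w).
  { exists u. split; [assumption | tauto]. }
  exists (exist _ (fun w => cauchy_seq A N w /\ same_limit N u w) h).
  split; [assumption |]. now apply same_limit_refl.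
Qed.

(** An element of the completion is a predicate on sequences together with a proof. Equality thus
    reduces to equivalence of the predicates through functional and propositional extensionality,
    and proof irrelevance settles the second component. *)
Lemma completion_eq (u w : nat -> T -> R) (U W : completion A N) :
  represents u U -> represents w W -> same_limit N u w -> U = W.
Proof.
  intros hu hw h.
  assert (hcu := represents_cauchy _ _ hu). assert (hcw := represents_cauchy _ _ hw).
  destruct U as [K [u0 [hu0 hK]]]; destruct W as [K' [w0 [hw0 hK']]].
  unfold represents in hu, hw; simpl in hu, hw.
  assert (e : K = K').
  { apply hK in hu. apply hK' in hw. destruct hu as [_ hu], hw as [_ hw].
    apply functional_extensionality. intro v. apply propositional_extensionality.
    rewrite hK, hK'.
    assert (h0 : same_limit N u0 w0).
    { apply same_limit_trans with u; try assumption.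
      apply same_limit_trans with w; try assumption. now apply same_limit_sym. }
    split; intros [hv hs]; (split; [assumption |]).
    - apply same_limit_trans with u0; try assumption. now apply same_limit_sym.
    - now apply same_limit_trans with w0. }
  subst K'. f_equal. apply proof_irrelevance.
Qed.

Section Forms.
Context {B : (T -> R) -> (T -> R) -> R} {F : (T -> R) -> R} {M C : R}.
Context (hB : psd_form A B) (hF : linear_form A F).
Context (hBN : forall u w, A u -> A w -> Rabs (B u w) <= M * (N u * N w)).
Context (hFN : forall u, A u -> Rabs (F u) <= C * N u).

Lemma linear_form_sub (u w : T -> R) : A u -> A w ->
  F (fun x => u x - w x) = F u - F w.
Proof.
  intros hu hw. rewrite sub_as_comb, (linear_form_comb _ _ hF) by assumption. ring.
Qed.

Lemma psd_sub_l (u w z : T -> R) : A u -> A w -> A z ->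
  B (fun x => u x - w x) z = B u z - B w z.
Proof.
  intros hu hw hz. rewrite sub_as_comb, (psd_comb_l _ _ hB) by assumption. ring.
Qed.

Lemma psd_sub_r (u w z : T -> R) : A u -> A w -> A z ->
  B z (fun x => u x - w x) = B z u - B z w.
Proof.
  intros hu hw hz. rewrite sub_as_comb, (psd_comb_r hA hB) by assumption. ring.
Qed.

(** The difference splits as B(u - u', v) + B(u', v - v'). With bounded norms this gives both the
    existence of the limit along Cauchy sequences and its independence of the representatives. *)
Lemma bounded_form_variation (u u' v v' : T -> R) : A u -> A u' -> A v -> A v' ->
  Rabs (B u v - B u' v')
  <= M * (N (fun x => u x - u' x) * N v) + M * (N u' * N (fun x => v x - v' x)).
Proof.
  intros hu hu' hv hv'.
  replace (B u v - B u' v')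
    with (B (fun x => u x - u' x) v + B u' (fun x => v x - v' x))
    by (rewrite psd_sub_l, psd_sub_r by assumption; ring).
  eapply Rle_trans; [apply Rabs_triang |].
  apply Rplus_le_compat; apply hBN; try apply (subspace_sub A); assumption.
Qed.

Lemma linear_form_cauchy (v : nat -> T -> R) : cauchy_seq A N v ->
  exists l : R, is_lim_seq (fun n => F (v n)) l.
Proof.
  intros [hv hc]. apply ex_lim_seq_cauchy_corr. intro e.
  (* The sign of [C] is not given, so it is raised to at least 1 before dividing by it. *)
  set (C' := Rmax C 1). assert (hC' : 1 <= C') by apply Rmax_r.
  destruct (hc (e / C')) as [m hm].
  { apply Rdiv_lt_0_compat; [apply cond_pos | lra]. }
  exists m. intros p q hp hq.
  rewrite <- linear_form_sub by apply hv.
  assert (hA' : A (fun x => v p x - v q x)) by now apply (subspace_sub A).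
  eapply Rle_lt_trans; [now apply hFN |].
  apply Rle_lt_trans with (C' * N (fun x => v p x - v q x)).
  { apply Rmult_le_compat_r; [now apply seminorm_nonneg | apply Rmax_l]. }
  specialize (hm p q hp hq).
  apply Rmult_lt_compat_l with (r := C') in hm; [| lra].
  replace (C' * (e / C')) with (pos e) in hm by (field; lra). exact hm.
Qed.

Lemma linear_form_same_limit (v w : nat -> T -> R) (l : R) :
  cauchy_seq A N v -> cauchy_seq A N w -> same_limit N v w ->
  is_lim_seq (fun n => F (v n)) l -> is_lim_seq (fun n => F (w n)) l.
Proof.
  intros [hv _] [hw _] h hl.
  apply is_lim_seq_ext with (fun n => F (v n) - F (fun x => v n x - w n x)).
  { intro n. rewrite linear_form_sub by auto. ring. }
  replace (Finite l) with (Finite (l - 0)) by (f_equal; ring).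
  apply is_lim_seq_minus'; [assumption |].
  apply is_lim_seq_abs_0.
  apply is_lim_seq_le_le with (fun _ => 0) (fun n => C * N (fun x => v n x - w n x)).
  - intro n. split; [apply Rabs_pos |]. now apply hFN, (subspace_sub A).
  - apply is_lim_seq_const.
  - replace (Finite 0) with (Rbar_mult C 0) by (simpl; f_equal; ring).
    now apply is_lim_seq_scal_l.
Qed.

(** [epsilon_spec] asks for one limit shared by all representatives of the class: completeness of
    the reals provides it along one of them, and the remaining ones differ by a null sequence. *)
Lemma extend1_lim (v : nat -> T -> R) (V : completion A N) :
  represents v V -> is_lim_seq (fun n => F (v n)) (extend1 F V).
Proof.
  intro hv. unfold extend1.
  apply (epsilon_spec (inhabits 0) (fun l : R =>
    forall v, represents v V -> is_lim_seq (fun n => F (v n)) l)); [| assumption].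
  assert (hcv := represents_cauchy _ _ hv).
  destruct (linear_form_cauchy v hcv) as [l hl].
  exists l. intros w hw.
  apply linear_form_same_limit with v; try assumption.
  - now apply represents_cauchy with V.
  - now apply represents_same_limit with V.
Qed.

Lemma bounded_form_cauchy (u v : nat -> T -> R) :
  cauchy_seq A N u -> cauchy_seq A N v ->
  exists l : R, is_lim_seq (fun n => B (u n) (v n)) l.
Proof.
  intros hu hv. apply ex_lim_seq_cauchy_corr. intro e.
  destruct (cauchy_seq_bounded u hu) as [K [hK [n1 h1]]].
  destruct (cauchy_seq_bounded v hv) as [K' [hK' [n2 h2]]].
  destruct hu as [hu hcu], hv as [hv hcv].
  (* The two terms of the variation are at most M' K' X and M' K Y, with X and Y the distances of
     the u's and of the v's; each is made smaller than e / 2. *)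
  set (M' := Rmax M 1). assert (hM' : 1 <= M') by apply Rmax_r.
  assert (hMM' : M <= M') by apply Rmax_l.
  assert (he := cond_pos e).
  destruct (hcu (e / (2 * M' * K'))) as [n3 h3].
  { apply Rdiv_lt_0_compat; [assumption |]. nra. }
  destruct (hcv (e / (2 * M' * K))) as [n4 h4].
  { apply Rdiv_lt_0_compat; [assumption |]. nra. }
  exists (n1 + n2 + n3 + n4)%nat. intros p q hp hq.
  specialize (h1 q ltac:(lia)). specialize (h2 p ltac:(lia)).
  specialize (h3 p q ltac:(lia) ltac:(lia)). specialize (h4 p q ltac:(lia) ltac:(lia)).
  eapply Rle_lt_trans; [now apply bounded_form_variation |].
  assert (g1 := seminorm_nonneg _ (subspace_sub A _ _ hA (hu p) (hu q))).
  assert (g2 := seminorm_nonneg _ (subspace_sub A _ _ hA (hv p) (hv q))).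
  assert (g3 := seminorm_nonneg _ (hu q)). assert (g4 := seminorm_nonneg _ (hv p)).
  set (X := N (fun x => u p x - u q x)) in *. set (Y := N (fun x => v p x - v q x)) in *.
  assert (i1 : M * (X * N (v p)) < e / 2).
  { apply Rle_lt_trans with (M' * K' * X).
    - apply Rle_trans with (M' * (X * N (v p))); [apply Rmult_le_compat_r; nra |].
      rewrite Rmult_assoc. apply Rmult_le_compat_l; nra.
    - replace (e / 2) with (M' * K' * (e / (2 * M' * K'))) by (field; lra).
      apply Rmult_lt_compat_l; nra. }
  assert (i2 : M * (N (u q) * Y) < e / 2).
  { apply Rle_lt_trans with (M' * K * Y).
    - apply Rle_trans with (M' * (N (u q) * Y)); [apply Rmult_le_compat_r; nra |].
      rewrite Rmult_assoc. apply Rmult_le_compat_l; nra.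
    - replace (e / 2) with (M' * K * (e / (2 * M' * K))) by (field; lra).
      apply Rmult_lt_compat_l; nra. }
  lra.
Qed.

Lemma bounded_form_same_limit (u u' v v' : nat -> T -> R) (l : R) :
  cauchy_seq A N u -> cauchy_seq A N u' -> cauchy_seq A N v -> cauchy_seq A N v' ->
  same_limit N u u' -> same_limit N v v' ->
  is_lim_seq (fun n => B (u n) (v n)) l -> is_lim_seq (fun n => B (u' n) (v' n)) l.
Proof.
  intros hu hu' hv hv' h1 h2 hl.
  destruct (cauchy_seq_bounded u' hu') as [K [hK [n1 k1]]].
  destruct (cauchy_seq_bounded v hv) as [K' [hK' [n2 k2]]].
  destruct hu as [hu _], hu' as [hu' _], hv as [hv _], hv' as [hv' _].
  set (M' := Rmax M 0). assert (hM' : 0 <= M') by apply Rmax_r.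
  assert (hMM' : M <= M') by apply Rmax_l.
  apply is_lim_seq_ext
    with (fun n => B (u n) (v n) - (B (u n) (v n) - B (u' n) (v' n))).
  { intro n. ring. }
  replace (Finite l) with (Finite (l - 0)) by (f_equal; ring).
  apply is_lim_seq_minus'; [assumption |].
  apply is_lim_seq_abs_0.
  apply is_lim_seq_le_le_loc with (fun _ => 0)
    (fun n => (M' * K') * N (fun x => u n x - u' n x)
              + (M' * K) * N (fun x => v n x - v' n x)).
  - exists (n1 + n2)%nat. intros n hn. split; [apply Rabs_pos |].
    specialize (k1 n ltac:(lia)). specialize (k2 n ltac:(lia)).
    eapply Rle_trans; [now apply bounded_form_variation |].
    assert (g1 := seminorm_nonneg _ (subspace_sub A _ _ hA (hu n) (hu' n))).
    assert (g2 := seminorm_nonneg _ (subspace_sub A _ _ hA (hv n) (hv' n))).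
    assert (g3 := seminorm_nonneg _ (hu' n)). assert (g4 := seminorm_nonneg _ (hv n)).
    set (X := N (fun x => u n x - u' n x)) in *.
    set (Y := N (fun x => v n x - v' n x)) in *.
    apply Rplus_le_compat.
    + apply Rle_trans with (M' * (X * N (v n))); [apply Rmult_le_compat_r; nra |].
      rewrite Rmult_assoc. apply Rmult_le_compat_l; nra.
    + apply Rle_trans with (M' * (N (u' n) * Y)); [apply Rmult_le_compat_r; nra |].
      rewrite Rmult_assoc. apply Rmult_le_compat_l; nra.
  - apply is_lim_seq_const.
  - replace (Finite 0) with (Finite (M' * K' * 0 + M' * K * 0)) by (f_equal; ring).
    apply is_lim_seq_plus'.
    + now apply (is_lim_seq_scal_l _ (M' * K') 0).
    + now apply (is_lim_seq_scal_l _ (M' * K) 0).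
Qed.

Lemma extend2_lim (u v : nat -> T -> R) (U V : completion A N) :
  represents u U -> represents v V ->
  is_lim_seq (fun n => B (u n) (v n)) (extend2 B U V).
Proof.
  intros hu hv. unfold extend2.
  apply (epsilon_spec (inhabits 0) (fun l : R => forall u v,
    represents u U -> represents v V -> is_lim_seq (fun n => B (u n) (v n)) l));
    try assumption.
  assert (hcu := represents_cauchy _ _ hu). assert (hcv := represents_cauchy _ _ hv).
  destruct (bounded_form_cauchy u v hcu hcv) as [l hl].
  exists l. intros u' v' hu' hv'.
  apply bounded_form_same_limit with u v; try assumption.
  - now apply represents_cauchy with U.
  - now apply represents_cauchy with V.
  - now apply represents_same_limit with U.
  - now apply represents_same_limit with V.
Qed.

End Forms.
End Completion.

(** * Minimization in the completion *)

Lemma is_lim_seq_sq_0 (a : nat -> R) :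
  is_lim_seq (fun n => a n ^ 2) 0 -> is_lim_seq a 0.
Proof.
  intro h. apply is_lim_seq_spec. intro e. apply is_lim_seq_spec in h.
  assert (he := cond_pos e).
  assert (he2 : 0 < e ^ 2) by now apply pow_lt.
  destruct (h (mkposreal _ he2)) as [n0 hn0].
  exists n0. intros n hn. specialize (hn0 n hn). simpl in hn0 |- *.
  rewrite Rminus_0_r in hn0 |- *.
  rewrite Rabs_pos_eq in hn0 by nra.
  apply Rabs_def1; nra.
Qed.

Lemma is_lim_seq_inv_S : is_lim_seq (fun n => / (INR n + 1)) 0.
Proof.
  apply is_lim_seq_ext with (fun n => / INR (S n)).
  { intro n. now rewrite S_INR. }
  apply is_lim_seq_spec. intro e.
  destruct (archimed_cor1 e (cond_pos e)) as [n0 [h1 h2]].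
  exists n0. intros n hn. rewrite Rminus_0_r.
  assert (hn0 : 0 < INR n0) by now apply lt_0_INR.
  assert (hle : INR n0 <= INR (S n)) by (apply le_INR; lia).
  rewrite Rabs_pos_eq.
  - apply Rle_lt_trans with (/ INR n0); [| assumption]. now apply Rinv_le_contravar.
  - apply Rlt_le, Rinv_0_lt_compat. lra.
Qed.

Section Minimization.
Context {T : Type} {A : (T -> R) -> Prop} {B : (T -> R) -> (T -> R) -> R}.
Context {F : (T -> R) -> R}.
Context (hA : subspace A) (hB : psd_form A B) (hF : linear_form A F).

Let gain (v : T -> R) : R := 2 * F v - B v v.

Lemma gain_comb (a b : R) (u w : T -> R) : A u -> A w ->
  gain (fun x => a * u x + b * w x)
  = 2 * (a * F u + b * F w)
    - (a ^ 2 * B u u + 2 * a * b * B u w + b ^ 2 * B w w).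
Proof.
  intros hu hw. unfold gain.
  now rewrite (psd_comb_diag hA hB), (linear_form_comb _ _ hF).
Qed.

Lemma maximizing_sequence (K : R) : (forall v, A v -> gain v <= K) ->
  exists (m : R) (u : nat -> T -> R),
    (forall v, A v -> gain v <= m) /\
    forall n, A (u n) /\ m - / (INR n + 1) < gain (u n).
Proof.
  intro hK.
  destruct (completeness (fun x => exists v, A v /\ x = gain v)) as [m [hub hlub]].
  - exists K. intros x [v [hv ->]]. now apply hK.
  - exists (gain (fun _ => 0)), (fun _ => 0). split; [apply hA | reflexivity].
  - assert (hex : forall n, exists v, A v /\ m - / (INR n + 1) < gain v).
    { intro n. apply NNPP. intro hno.
      assert (hpos : 0 < / (INR n + 1)).
      { apply Rinv_0_lt_compat. assert (h := pos_INR n). lra. }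
      assert (hm : m <= m - / (INR n + 1)); [| lra].
      apply hlub. intros x [v [hv ->]].
      apply Rnot_lt_le. intro hlt. apply hno. now exists v. }
    (* The supremum need not be attained on [A], so a near-maximizer is chosen for each tolerance 1
       / (n + 1). *)
    exists m, (fun n => proj1_sig (constructive_indefinite_description _ (hex n))).
    split.
    + intros v hv. apply hub. now exists v.
    + intro n. apply (proj2_sig (constructive_indefinite_description _ (hex n))).
Qed.

(* Parallelogram law: 4 G((u+w)/2) - 2 G(u) - 2 G(w) = B(u-w, u-w) for the gain G. *)
Lemma near_maximizers_close (m d e : R) (u w : T -> R) :
  (forall v, A v -> gain v <= m) -> A u -> A w -> m - d < gain u -> m - e < gain w ->
  B (fun x => u x - w x) (fun x => u x - w x) <= 2 * d + 2 * e.
Proof.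
  intros hm hu hw hgu hgw.
  assert (h := hm _ (subspace_comb _ hA (1 / 2) (1 / 2) u w hu hw)).
  rewrite gain_comb in h by assumption.
  rewrite sub_as_comb, (psd_comb_diag hA hB) by assumption.
  unfold gain in hgu, hgw. lra.
Qed.

(** Comparing the gains of u + t v and of u shows that B(v, v) t^2 + 2 (B(u, v) - F v) t + d is
    nonnegative for all t; its discriminant bounds the defect in the weak equation by the deficit d
    of u. This quantitative form replaces the vanishing derivative at a maximizer, which may not
    exist in [A]. *)
Lemma near_maximizer_weak (m d : R) (u v : T -> R) :
  (forall v, A v -> gain v <= m) -> A u -> A v -> m - d < gain u ->
  (B u v - F v) ^ 2 <= B v v * d.
Proof.
  intros hm hu hv hgu.
  apply nonneg_quadratic_discriminant; [now apply hB |].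
  intro t.
  assert (h := hm _ (subspace_comb _ hA 1 t u v hu hv)).
  rewrite gain_comb in h by assumption.
  unfold gain in hgu. lra.
Qed.
End Minimization.

(** * Riesz representation for a form equivalent to the squared norm *)

Section Riesz.
Context {T : Type} {A : (T -> R) -> Prop} {E B : (T -> R) -> (T -> R) -> R}.
Context {N F : (T -> R) -> R} {al M a b : R}.
Context (hA : subspace A) (hE : psd_form A E).
Context (hN : forall u, A u -> N u = sqrt (E u u)).
Context (hB : psd_form A B) (hF : linear_form A F).
Context (hal : 0 < al) (hlow : forall u, A u -> al * E u u <= B u u).
Context (hM : 0 <= M) (hup : forall u, A u -> B u u <= M * E u u).
Context (hb : 0 <= b) (hFE : forall u, A u -> F u <= a + b * E u u).

Lemma seminorm_sq (u : T -> R) : A u -> N u ^ 2 = E u u.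
Proof. intro hu. rewrite hN by assumption. now apply pow2_sqrt, hE. Qed.

Lemma psd_bounded (u w : T -> R) : A u -> A w -> Rabs (B u w) <= M * (N u * N w).
Proof.
  intros hu hw.
  eapply Rle_trans; [now apply (psd_cauchy_schwarz_sqrt hA hB) |].
  replace (M * (N u * N w)) with ((sqrt M * N u) * (sqrt M * N w)).
  2: { rewrite <- (sqrt_sqrt M) at 3 by assumption. ring. }
  assert (h : forall z, A z -> sqrt (B z z) <= sqrt M * N z).
  { intros z hz. rewrite hN by assumption.
    rewrite <- sqrt_mult_alt by assumption. apply sqrt_le_1_alt. now apply hup. }
  apply Rmult_le_compat; try apply sqrt_pos; now apply h.
Qed.

(** Applied to t u, the hypothesis says that b E(u, u) t^2 - F(u) t + a is nonnegative for all t, so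
    F(u)^2 <= 4 a b E(u, u); hence the constant. Assuming only an affine one-sided bound on F lets
    Young's inequality supply it directly. *)
Lemma linear_form_bounded (u : T -> R) : A u -> Rabs (F u) <= (2 * sqrt (a * b)) * N u.
Proof.
  intro hu.
  (* The bound at the zero function forces [a] to be nonnegative, which the square root of a b
     requires. *)
  assert (ha : 0 <= a).
  { assert (h0 : F (fun _ : T => 0) = 0).
    { replace (fun _ : T => 0) with (fun x => 0 * u x + 0 * u x)
        by (apply functional_extensionality; intro; ring).
      rewrite (linear_form_comb _ _ hF) by assumption. ring. }
    assert (hE0 : E (fun _ : T => 0) (fun _ => 0) = 0).
    { replace (fun _ : T => 0) with (fun x => 0 * u x + 0 * u x)
        by (apply functional_extensionality; intro; ring).
      rewrite (psd_comb_diag hA hE) by assumption. ring. }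
    assert (h := hFE _ (subspace_zero _ hA)). rewrite h0, hE0 in h. lra. }
  assert (h : (- F u / 2) ^ 2 <= (b * E u u) * a).
  { apply nonneg_quadratic_discriminant.
    - apply Rmult_le_pos; [assumption | now apply hE].
    - intro t. assert (h := hFE _ (subspace_comb _ hA t 0 u u hu hu)).
      rewrite (linear_form_comb _ _ hF), (psd_comb_diag hA hE) in h by assumption.
      lra. }
  rewrite <- (sqrt_Rsqr_abs (F u)), hN, Rmult_assoc by assumption.
  rewrite <- sqrt_mult_alt by nra.
  replace 2 with (sqrt (2 * 2)) by (apply sqrt_square; lra).
  rewrite <- sqrt_mult_alt by lra.
  apply sqrt_le_1_alt. unfold Rsqr. lra.
Qed.

(** By coercivity the gain is at most 2 C N - al N^2, and completing the square bounds this by C^2 /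
    al. So the supremum is finite. *)
Lemma gain_bounded (v : T -> R) : A v ->
  2 * F v - B v v <= (2 * sqrt (a * b)) ^ 2 / al.
Proof.
  intro hv.
  assert (h1 := hlow v hv). rewrite <- seminorm_sq in h1 by assumption.
  assert (h2 := linear_form_bounded v hv). assert (h3 := Rle_abs (F v)).
  set (C := 2 * sqrt (a * b)) in *.
  assert (h : 0 <= (al * N v - C) ^ 2 / al).
  { apply Rle_mult_inv_pos; [apply pow2_ge_0 | assumption]. }
  replace ((al * N v - C) ^ 2 / al)
    with (al * N v ^ 2 - 2 * (C * N v) + C ^ 2 / al) in h by (field; lra).
  lra.
Qed.

Lemma psd_lim_0_same_limit (u w : nat -> T -> R) :
  cauchy_seq A N u -> cauchy_seq A N w ->
  is_lim_seq (fun n => B (fun x => u n x - w n x) (fun x => u n x - w n x)) 0 ->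
  same_limit N u w.
Proof.
  intros [hu _] [hw _] h. apply is_lim_seq_sq_0.
  apply is_lim_seq_le_le with (fun _ => 0)
    (fun n => / al * B (fun x => u n x - w n x) (fun x => u n x - w n x)).
  - intro n. split; [apply pow2_ge_0 |].
    assert (hs := subspace_sub A _ _ hA (hu n) (hw n)).
    rewrite seminorm_sq by assumption.
    apply Rmult_le_reg_l with al; [assumption |].
    rewrite <- Rmult_assoc, Rinv_r, Rmult_1_l by lra. now apply hlow.
  - apply is_lim_seq_const.
  - replace (Finite 0) with (Rbar_mult (/ al) 0) by (simpl; f_equal; ring).
    now apply is_lim_seq_scal_l.
Qed.

Lemma minimizing_sequence_cauchy (m : R) (u : nat -> T -> R) :
  (forall v, A v -> 2 * F v - B v v <= m) ->
  (forall n, A (u n) /\ m - / (INR n + 1) < 2 * F (u n) - B (u n) (u n)) ->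
  cauchy_seq A N u.
Proof.
  intros hm hu. split; [intro n; apply hu |].
  intros e he.
  assert (hl := is_lim_seq_inv_S). apply is_lim_seq_spec in hl.
  (* The parallelogram bound is twice the sum of two deficits. With each below al e^2 / 4,
     coercivity leaves al N^2 < al e^2. *)
  assert (hpos : 0 < al * e ^ 2 / 4) by (assert (0 < e ^ 2) by nra; nra).
  destruct (hl (mkposreal _ hpos)) as [n0 hn0]. exists n0. intros p q hp hq.
  destruct (hu p) as [hAp hgp], (hu q) as [hAq hgq].
  assert (h := near_maximizers_close hA hB hF m _ _ _ _ hm hAp hAq hgp hgq).
  apply hn0 in hp. apply hn0 in hq. simpl in hp, hq.
  rewrite Rminus_0_r in hp, hq.
  apply Rabs_def2 in hp. apply Rabs_def2 in hq.
  assert (hs := subspace_sub A _ _ hA hAp hAq).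
  assert (hlo := hlow _ hs). rewrite <- seminorm_sq in hlo by assumption.
  assert (hn := seminorm_nonneg hN _ hs).
  set (X := N (fun x => u p x - u q x)) in *.
  assert (hX : al * X ^ 2 < al * e ^ 2) by lra.
  apply Rmult_lt_reg_l in hX; [| assumption].
  apply Rnot_le_lt. intro hle. nra.
Qed.

(** The difference of the two sides is the limit of B(u n, v n) - F(v n). By [near_maximizer_weak]
    its square is at most B(v n, v n) / (n + 1), and B(v n, v n) is eventually at most M K^2 because
    Cauchy sequences are bounded. *)
Lemma minimizing_sequence_weak_solution (m : R) (u : nat -> T -> R) (U V : completion A N) :
  (forall v, A v -> 2 * F v - B v v <= m) ->
  (forall n, A (u n) /\ m - / (INR n + 1) < 2 * F (u n) - B (u n) (u n)) ->
  represents u U -> extend2 B U V = extend1 F V.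
Proof.
  intros hm hu hU.
  destruct (represents_exists hA hE hN V) as [v hv].
  assert (h1 := extend1_lim hA hE hN hF linear_form_bounded v V hv).
  assert (h2 := extend2_lim hA hE hN hB psd_bounded u v U V hU hv).
  assert (h3 := is_lim_seq_minus' _ _ _ _ h2 h1).
  assert (hcv := represents_cauchy _ _ hv).
  destruct (cauchy_seq_bounded hA hE hN v hcv) as [K [hK [n0 hn0]]].
  destruct hcv as [hAv _].
  assert (h4 : is_lim_seq (fun n => B (u n) (v n) - F (v n)) 0).
  { apply is_lim_seq_sq_0.
    apply is_lim_seq_le_le_loc with (fun _ => 0)
      (fun n => M * K ^ 2 * / (INR n + 1)).
    - exists n0. intros n hn. split; [apply pow2_ge_0 |].
      destruct (hu n) as [hAn hgn].
      eapply Rle_trans; [exact (near_maximizer_weak hA hB hF m _ _ _ hm hAn (hAv n) hgn) |].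
      apply Rmult_le_compat_r.
      + apply Rlt_le, Rinv_0_lt_compat. assert (h := pos_INR n). lra.
      + eapply Rle_trans; [now apply hup |]. rewrite <- seminorm_sq by apply hAv.
        apply Rmult_le_compat_l; [assumption |].
        apply pow_incr. split; [now apply (seminorm_nonneg hN) | now apply hn0].
    - apply is_lim_seq_const.
    - replace (Finite 0) with (Rbar_mult (M * K ^ 2) 0) by (simpl; f_equal; ring).
      apply is_lim_seq_scal_l, is_lim_seq_inv_S. }
  apply is_lim_seq_unique in h3. apply is_lim_seq_unique in h4.
  rewrite h3 in h4. injection h4. lra.
Qed.

(** Testing with the class V of u - w makes B(u n - w n, u n - w n) tend to 0; coercivity then puts
    u and w in the same class. *)
Lemma weak_solution_unique (U W : completion A N) :
  (forall V : completion A N, extend2 B U V = extend2 B W V) -> U = W.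
Proof.
  intro h.
  destruct (represents_exists hA hE hN U) as [u hu].
  destruct (represents_exists hA hE hN W) as [w hw].
  assert (hcu := represents_cauchy _ _ hu). assert (hcw := represents_cauchy _ _ hw).
  destruct (completion_class hA hE hN _ (cauchy_seq_sub hA hE hN u w hcu hcw)) as [V hV].
  specialize (h V).
  assert (h1 := extend2_lim hA hE hN hB psd_bounded _ _ U V hu hV).
  assert (h2 := extend2_lim hA hE hN hB psd_bounded _ _ W V hw hV).
  rewrite h in h1.
  assert (h3 := is_lim_seq_minus' _ _ _ _ h1 h2). rewrite Rminus_diag in h3.
  apply (completion_eq hA hE hN u w U W hu hw).
  apply psd_lim_0_same_limit; try assumption.
  revert h3. apply is_lim_seq_ext. intro n.
  destruct hcu as [hAu _], hcw as [hAw _].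
  rewrite (psd_sub_l hB); auto. now apply (subspace_sub A).
Qed.

Theorem completion_riesz :
  exists! U : completion A N, forall V : completion A N, extend2 B U V = extend1 F V.
Proof.
  destruct (maximizing_sequence hA _ gain_bounded) as [m [u [hm hu]]].
  destruct (completion_class hA hE hN u (minimizing_sequence_cauchy m u hm hu)) as [U hU].
  exists U. split.
  - intro V. now apply minimizing_sequence_weak_solution with m u.
  - intros W hW. apply weak_solution_unique. intro V. rewrite hW.
    now apply minimizing_sequence_weak_solution with m u.
Qed.
End Riesz.

(** * Iterated integrals *)

(** Retraction of the line onto [a, b]. Composing with it extends a function continuous on [a, b] to
    one continuous everywhere with the same values there. *)
Definition clamp (a b x : R) : R := Rmax a (Rmin b x).

Lemma clamp_bounds (a b x : R) : a <= b -> a <= clamp a b x <= b.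
Proof. intro h. unfold clamp, Rmax, Rmin. repeat destruct Rle_dec; lra. Qed.

Lemma clamp_id (a b x : R) : a <= x <= b -> clamp a b x = x.
Proof. intro h. unfold clamp, Rmax, Rmin. repeat destruct Rle_dec; lra. Qed.

Lemma clamp_lipschitz (a b x y : R) : Rabs (clamp a b x - clamp a b y) <= Rabs (x - y).
Proof.
  unfold clamp, Rmax, Rmin, Rabs.
  repeat destruct Rle_dec; repeat destruct Rcase_abs; lra.
Qed.

Lemma continuous_clamp (a b x : R) : continuous (clamp a b) x.
Proof.
  apply filterlim_locally. intro e. exists e. intros y hy.
  change (Rabs (clamp a b y - clamp a b x) < e). change (Rabs (y - x) < e) in hy.
  eapply Rle_lt_trans; [apply clamp_lipschitz | assumption].
Qed.

(* Uniformity in t over [a, b] comes from a Lebesgue number of the cover of {u0} x [a, b]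
   by balls on which F oscillates little. *)
Lemma continuous_RInt_param {U : UniformSpace} (F : U -> R -> R) (a b : R) :
  a <= b -> (forall p : U * R, continuous (fun q : U * R => F (fst q) (snd q)) p) ->
  forall u0, continuous (fun u => RInt (F u) a b) u0.
Proof.
  intros hab hF u0.
  assert (hex : forall u, ex_RInt (F u) a b).
  { intro u. apply (ex_RInt_continuous (V := R_CompleteNormedModule)). intros t _.
    apply (continuous_comp_2 (fun _ : R => u) (fun x => x) F).
    - apply continuous_const.
    - apply continuous_id.
    - apply hF. }
  apply filterlim_locally. intro e. assert (he := cond_pos e).
  (* The integrands will differ by at most 2 e', so their integrals by at most 2 (b - a) e' <= e /
     2. The added 1 keeps the denominator positive when a = b. *)
  assert (he' : 0 < e / (4 * (b - a + 1))) by (apply Rdiv_lt_0_compat; lra).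
  set (e' := mkposreal _ he').
  assert (hd : forall t : R, exists d : posreal, forall u s, ball u0 d u ->
            Rabs (s - t) < d -> Rabs (F u s - F u0 t) < e').
  { intro t. destruct (proj1 (filterlim_locally _ _) (hF (u0, t)) e') as [d h].
    exists d. intros u s hu hs. apply (h (u, s)). now split. }
  destruct (compactness_value_1d a b
    (fun t => proj1_sig (constructive_indefinite_description _ (hd t)))) as [d hdd].
  exists d. intros u hu.
  change (Rabs (RInt (F u) a b - RInt (F u0) a b) < e).
  rewrite <- (RInt_minus (V := R_CompleteNormedModule)) by apply hex.
  apply Rle_lt_trans with ((b - a) * (2 * e')).
  - apply abs_RInt_le_const; [assumption | now apply (ex_RInt_minus (V := R_NormedModule)) |].
    (* [compactness_value_1d] yields a nearby centre t only under a double negation, hence the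
       argument by contradiction. Both F u s and F u0 s are compared with F u0 t. *)
    intros s hs. apply Rnot_lt_le. intro hlt.
    apply (hdd s hs). intros [t [_ [h1 h2]]].
    destruct (constructive_indefinite_description _ (hd t)) as [dt hdt]. simpl in h1, h2.
    assert (i1 : Rabs (F u s - F u0 t) < e').
    { apply hdt; [| assumption]. now apply ball_le with d. }
    assert (i2 : Rabs (F u0 s - F u0 t) < e').
    { apply hdt; [| assumption]. apply ball_center. }
    change (2 * e' < Rabs (F u s - F u0 s)) in hlt.
    apply Rabs_def2 in i1. apply Rabs_def2 in i2.
    assert (i3 : Rabs (F u s - F u0 s) < 2 * e') by (apply Rabs_def1; lra). lra.
  - simpl. apply Rle_lt_trans with (e / 2); [| lra].
    apply Rmult_le_reg_r with (4 * (b - a + 1)); [lra |].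
    replace ((b - a) * (2 * (e / (4 * (b - a + 1)))) * (4 * (b - a + 1)))
      with (2 * (b - a) * e) by (field; lra).
    nra.
Qed.

Lemma RInt_comb (f g : R -> R) (a b s t : R) :
  ex_RInt f a b -> ex_RInt g a b ->
  RInt (fun x => s * f x + t * g x) a b = s * RInt f a b + t * RInt g a b.
Proof.
  intros hf hg.
  rewrite <- (RInt_scal (V := R_CompleteNormedModule) f) by assumption.
  rewrite <- (RInt_scal (V := R_CompleteNormedModule) g) by assumption.
  now apply (RInt_plus (V := R_CompleteNormedModule)); apply (ex_RInt_scal (V := R_NormedModule)).
Qed.

Lemma ex_RInt_continuous_everywhere (f : R -> R) (a b : R) :
  (forall x, continuous f x) -> ex_RInt f a b.
Proof. intro h. apply (ex_RInt_continuous (V := R_CompleteNormedModule)). intros; apply h. Qed.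

(* The integrands are built from two-sided derivatives, which are junk on the faces, so
   only their values at interior points are required to extend continuously. *)
Definition continuous_inside2 (L : R) (g : R -> R -> R) : Prop :=
  exists G : R * R -> R, (forall p, continuous G p) /\
    forall theta y, 0 < y < L -> g theta y = G (theta, y).

Definition continuous_inside3 (R1 R2 L : R) (g : R -> R -> R -> R) : Prop :=
  exists G : point -> R, (forall p, continuous G p) /\
    forall rho theta y, R1 < rho < R2 -> 0 < y < L -> g rho theta y = G (rho, theta, y).

Lemma int_C2_ext (L : R) (f g : R -> R -> R) : 0 < L ->
  (forall theta y, 0 < y < L -> f theta y = g theta y) -> int_C2 L f = int_C2 L g.
Proof.
  intros hL h. unfold int_C2. apply RInt_ext. intros theta _.
  apply RInt_ext. intros y hy. rewrite Rmin_left, Rmax_right in hy by lra. now apply h.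
Qed.

Lemma int_Q_ext (R1 R2 L : R) (f g : R -> R -> R -> R) : R1 < R2 -> 0 < L ->
  (forall rho theta y, R1 < rho < R2 -> 0 < y < L -> f rho theta y = g rho theta y) ->
  int_Q R1 R2 L f = int_Q R1 R2 L g.
Proof.
  intros hR hL h. unfold int_Q. apply RInt_ext. intros theta _.
  apply RInt_ext. intros rho hr. rewrite Rmin_left, Rmax_right in hr by lra.
  apply RInt_ext. intros y hy. rewrite Rmin_left, Rmax_right in hy by lra.
  now apply h.
Qed.

(** * Linearity and positivity of the iterated integrals *)

Section ContinuousIntegrals.
Context {R1 R2 L : R} (hR : R1 < R2) (hL : 0 < L).

Lemma continuous_slice2 (G : R * R -> R) (theta : R) :
  (forall p, continuous G p) -> forall y, continuous (fun y => G (theta, y)) y.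
Proof.
  intros hG y.
  apply (continuous_comp_2 (fun _ : R => theta) (fun y : R => y) (fun a b => G (a, b))).
  - apply continuous_const.
  - apply continuous_id.
  - apply continuous_ext with G; [now intros [] | apply hG].
Qed.

Lemma continuous_int_y2 (G : R * R -> R) :
  (forall p, continuous G p) ->
  forall theta, continuous (fun theta => RInt (fun y => G (theta, y)) 0 L) theta.
Proof.
  intros hG theta.
  apply (continuous_RInt_param (fun theta y => G (theta, y))); [lra |].
  intro p. apply continuous_ext with G; [now intros [] | apply hG].
Qed.

Lemma continuous_slice3 (G : point -> R) (rho theta : R) :
  (forall p, continuous G p) -> forall y, continuous (fun y => G (rho, theta, y)) y.
Proof.
  intros hG y.
  apply (continuous_comp_2 (fun _ : R => (rho, theta)) (fun y : R => y)
           (fun a b => G (a, b))).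
  - apply continuous_const.
  - apply continuous_id.
  - apply continuous_ext with G; [now intros [] | apply hG].
Qed.

(** The pair is ordered as (theta, rho), so that theta is the parameter and rho the variable in the
    next integration. *)
Lemma continuous_int_y3 (G : point -> R) :
  (forall p, continuous G p) ->
  forall q : R * R, continuous (fun q : R * R => RInt (fun y => G (snd q, fst q, y)) 0 L) q.
Proof.
  intros hG q.
  apply (continuous_RInt_param (fun (q : R * R) y => G (snd q, fst q, y))); [lra |].
  intro p.
  apply (continuous_comp_2 (fun x : R * R * R => (snd (fst x), fst (fst x)))
           (fun x => snd x) (fun a b => G (a, b))).
  - apply (continuous_comp_2 (fun x : R * R * R => snd (fst x)) (fun x => fst (fst x))
             (fun a b => (a, b))).
    + apply (continuous_comp fst snd); [apply continuous_fst | apply continuous_snd].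
    + apply (continuous_comp fst fst); [apply continuous_fst | apply continuous_fst].
    + apply continuous_ext with (fun x => x); [now intros [] | apply continuous_id].
  - apply continuous_snd.
  - apply continuous_ext with G; [now intros [] | apply hG].
Qed.

Lemma continuous_int_y (G : point -> R) (theta : R) :
  (forall p, continuous G p) ->
  forall rho, continuous (fun rho => RInt (fun y => G (rho, theta, y)) 0 L) rho.
Proof.
  intros hG. exact (continuous_slice2 _ theta (continuous_int_y3 _ hG)).
Qed.

Lemma continuous_int_rho_y (G : point -> R) :
  (forall p, continuous G p) ->
  forall theta, continuous
    (fun theta => RInt (fun rho => RInt (fun y => G (rho, theta, y)) 0 L) R1 R2) theta.
Proof.
  intros hG theta.
  apply (continuous_RInt_param
           (fun theta rho => RInt (fun y => G (rho, theta, y)) 0 L)); [lra |].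
  intro p. now apply continuous_int_y3.
Qed.

Lemma int_C2_comb (f g : R -> R -> R) (s t : R) :
  continuous_inside2 L f -> continuous_inside2 L g ->
  int_C2 L (fun theta y => s * f theta y + t * g theta y)
  = s * int_C2 L f + t * int_C2 L g.
Proof.
  intros [F [hF ef]] [G [hG eg]].
  rewrite (int_C2_ext L _ (fun theta y => F (theta, y)) hL ef),
          (int_C2_ext L _ (fun theta y => G (theta, y)) hL eg).
  rewrite (int_C2_ext L _ (fun theta y => s * F (theta, y) + t * G (theta, y)) hL).
  2: { intros theta y hy. now rewrite ef, eg. }
  unfold int_C2.
  rewrite <- RInt_comb
    by (apply ex_RInt_continuous_everywhere; now apply continuous_int_y2).
  apply RInt_ext. intros theta _.
  apply RInt_comb; apply ex_RInt_continuous_everywhere; now apply continuous_slice2.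
Qed.

Lemma int_Q_comb (f g : R -> R -> R -> R) (s t : R) :
  continuous_inside3 R1 R2 L f -> continuous_inside3 R1 R2 L g ->
  int_Q R1 R2 L (fun rho theta y => s * f rho theta y + t * g rho theta y)
  = s * int_Q R1 R2 L f + t * int_Q R1 R2 L g.
Proof.
  intros [F [hF ef]] [G [hG eg]].
  rewrite (int_Q_ext R1 R2 L _ (fun rho theta y => F (rho, theta, y)) hR hL ef),
          (int_Q_ext R1 R2 L _ (fun rho theta y => G (rho, theta, y)) hR hL eg).
  rewrite (int_Q_ext R1 R2 L _
             (fun rho theta y => s * F (rho, theta, y) + t * G (rho, theta, y)) hR hL).
  2: { intros rho theta y hr hy. now rewrite ef, eg. }
  unfold int_Q.
  rewrite <- RInt_comb
    by (apply ex_RInt_continuous_everywhere; now apply continuous_int_rho_y).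
  apply RInt_ext. intros theta _.
  rewrite <- RInt_comb
    by (apply ex_RInt_continuous_everywhere; now apply continuous_int_y).
  apply RInt_ext. intros rho _.
  apply RInt_comb; apply ex_RInt_continuous_everywhere; now apply continuous_slice3.
Qed.

Lemma int_C2_nonneg (f : R -> R -> R) :
  continuous_inside2 L f -> (forall theta y, 0 < y < L -> 0 <= f theta y) ->
  0 <= int_C2 L f.
Proof.
  intros [F [hF ef]] hf.
  rewrite (int_C2_ext L _ (fun theta y => F (theta, y)) hL ef).
  assert (hpi := PI_RGT_0).
  apply RInt_ge_0; [lra | apply ex_RInt_continuous_everywhere; now apply continuous_int_y2 |].
  intros theta _.
  apply RInt_ge_0; [lra | apply ex_RInt_continuous_everywhere; now apply continuous_slice2 |].
  intros y hy. rewrite <- ef by assumption. now apply hf.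
Qed.

Lemma int_Q_nonneg (f : R -> R -> R -> R) :
  continuous_inside3 R1 R2 L f ->
  (forall rho theta y, R1 < rho < R2 -> 0 < y < L -> 0 <= f rho theta y) ->
  0 <= int_Q R1 R2 L f.
Proof.
  intros [F [hF ef]] hf.
  rewrite (int_Q_ext R1 R2 L _ (fun rho theta y => F (rho, theta, y)) hR hL ef).
  assert (hpi := PI_RGT_0).
  apply RInt_ge_0;
    [lra | apply ex_RInt_continuous_everywhere; now apply continuous_int_rho_y |].
  intros theta _.
  apply RInt_ge_0;
    [lra | apply ex_RInt_continuous_everywhere; now apply continuous_int_y |].
  intros rho hr.
  apply RInt_ge_0; [lra | apply ex_RInt_continuous_everywhere; now apply continuous_slice3 |].
  intros y hy. rewrite <- ef by assumption. now apply hf.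
Qed.

Lemma int_C2_le (f g : R -> R -> R) (s : R) :
  continuous_inside2 L f -> continuous_inside2 L g ->
  (forall theta y, 0 < y < L -> f theta y <= s * g theta y) ->
  int_C2 L f <= s * int_C2 L g.
Proof.
  intros hf hg h.
  assert (hn : 0 <= int_C2 L (fun theta y => s * g theta y + (-1) * f theta y)).
  { apply int_C2_nonneg.
    - destruct hf as [F [hF ef]], hg as [G [hG eg]].
      exists (fun p => s * G p + (-1) * F p). split.
      + intro p. apply (continuous_plus (V := R_NormedModule));
          apply (continuous_mult (K := R_AbsRing)); auto; apply continuous_const.
      + intros theta y hy. now rewrite ef, eg.
    - intros theta y hy. specialize (h theta y hy). lra. }
  rewrite int_C2_comb in hn by assumption. lra.
Qed.

(** * Interior continuity of composite integrands *)

Lemma continuous_inside2_plus (f g : R -> R -> R) :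
  continuous_inside2 L f -> continuous_inside2 L g ->
  continuous_inside2 L (fun theta y => f theta y + g theta y).
Proof.
  intros [F [hF ef]] [G [hG eg]]. exists (fun p => F p + G p). split.
  - intro p. now apply (continuous_plus (V := R_NormedModule)).
  - intros theta y hy. now rewrite ef, eg.
Qed.

Lemma continuous_inside2_mult (f g : R -> R -> R) :
  continuous_inside2 L f -> continuous_inside2 L g ->
  continuous_inside2 L (fun theta y => f theta y * g theta y).
Proof.
  intros [F [hF ef]] [G [hG eg]]. exists (fun p => F p * G p). split.
  - intro p. now apply (continuous_mult (K := R_AbsRing)).
  - intros theta y hy. now rewrite ef, eg.
Qed.

Lemma continuous_inside2_const (s : R) : continuous_inside2 L (fun _ _ => s).
Proof. exists (fun _ => s). split; [intro; apply continuous_const | reflexivity]. Qed.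

Lemma continuous_inside2_theta (f : R -> R) :
  (forall x, continuous f x) -> continuous_inside2 L (fun theta _ => f theta).
Proof.
  intro hf. exists (fun p => f (fst p)). split; [| reflexivity].
  intro p. apply (continuous_comp fst f); [apply continuous_fst | apply hf].
Qed.

Lemma continuous_inside2_y (f : R -> R) :
  (forall x, continuous f x) -> continuous_inside2 L (fun _ y => f y).
Proof.
  intro hf. exists (fun p => f (snd p)). split; [| reflexivity].
  intro p. apply (continuous_comp snd f); [apply continuous_snd | apply hf].
Qed.

Lemma continuous_inside3_plus (f g : R -> R -> R -> R) :
  continuous_inside3 R1 R2 L f -> continuous_inside3 R1 R2 L g ->
  continuous_inside3 R1 R2 L (fun rho theta y => f rho theta y + g rho theta y).
Proof.
  intros [F [hF ef]] [G [hG eg]]. exists (fun p => F p + G p). split.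
  - intro p. now apply (continuous_plus (V := R_NormedModule)).
  - intros rho theta y hr hy. now rewrite ef, eg.
Qed.

Lemma continuous_inside3_mult (f g : R -> R -> R -> R) :
  continuous_inside3 R1 R2 L f -> continuous_inside3 R1 R2 L g ->
  continuous_inside3 R1 R2 L (fun rho theta y => f rho theta y * g rho theta y).
Proof.
  intros [F [hF ef]] [G [hG eg]]. exists (fun p => F p * G p). split.
  - intro p. now apply (continuous_mult (K := R_AbsRing)).
  - intros rho theta y hr hy. now rewrite ef, eg.
Qed.

(** Continuity is asked only on [R1, R2] because the weight 1 / rho^2 is singular at 0; clamping
    provides the extension. *)
Lemma continuous_inside3_rho (f : R -> R) :
  (forall x, R1 <= x <= R2 -> continuous f x) ->
  continuous_inside3 R1 R2 L (fun rho _ _ => f rho).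
Proof.
  intro hf. exists (fun p => f (clamp R1 R2 (fst (fst p)))). split.
  - intro p.
    apply (continuous_comp (fun p : point => clamp R1 R2 (fst (fst p))) f).
    + apply (continuous_comp (fun p : point => fst (fst p)) (clamp R1 R2)).
      * apply (continuous_comp fst fst); apply continuous_fst.
      * apply continuous_clamp.
    + apply hf, clamp_bounds. lra.
  - intros rho theta y hr hy. simpl. rewrite clamp_id by lra. reflexivity.
Qed.

Definition clamp_point (p : point) : point :=
  (clamp R1 R2 (fst (fst p)), snd (fst p), clamp 0 L (snd p)).

Lemma Qbar_clamp_point (p : point) : Qbar R1 R2 L (clamp_point p).
Proof. split; apply clamp_bounds; lra. Qed.

(** Clamping does not increase distances in any coordinate and balls in the product are taken
    coordinatewise, so the radius valid for w at the clamped point serves unchanged. *)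
Lemma continuous_clamp_extension (w : point -> R) :
  continuous_on (Qbar R1 R2 L) w -> forall p, continuous (fun p => w (clamp_point p)) p.
Proof.
  intros hw p. apply filterlim_locally. intro e.
  destruct (proj1 (filterlim_locally _ _) (hw _ (Qbar_clamp_point p)) e) as [d hd].
  exists d. intros q [[h1 h2] h3].
  apply hd; [| apply Qbar_clamp_point].
  repeat split.
  - eapply Rle_lt_trans; [apply clamp_lipschitz | exact h1].
  - exact h2.
  - eapply Rle_lt_trans; [apply clamp_lipschitz | exact h3].
Qed.

Lemma continuous_on_inside3 (w : point -> R) :
  continuous_on (Qbar R1 R2 L) w ->
  continuous_inside3 R1 R2 L (fun rho theta y => w (rho, theta, y)).
Proof.
  intro hw. exists (fun p => w (clamp_point p)). split.
  - now apply continuous_clamp_extension.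
  - intros rho theta y hr hy. unfold clamp_point; simpl. now rewrite !clamp_id by lra.
Qed.

Lemma continuous_on_inside2 (w : point -> R) :
  continuous_on (Qbar R1 R2 L) w ->
  continuous_inside2 L (fun theta y => w (R2, theta, y)).
Proof.
  intro hw. exists (fun q => w (clamp_point (R2, fst q, snd q))). split.
  - intro q.
    apply (continuous_comp (fun q : R * R => (R2, fst q, snd q))
             (fun p => w (clamp_point p))).
    + apply (continuous_comp_2 (fun q : R * R => (R2, fst q)) snd (fun a b => (a, b))).
      * apply (continuous_comp_2 (fun _ : R * R => R2) fst (fun a b => (a, b))).
        -- apply continuous_const.
        -- apply continuous_fst.
        -- apply continuous_ext with (fun x => x); [now intros [] | apply continuous_id].
      * apply continuous_snd.
      * apply continuous_ext with (fun x => x); [now intros [] | apply continuous_id].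
    + now apply continuous_clamp_extension.
  - intros theta y hy. unfold clamp_point; simpl. now rewrite !clamp_id by lra.
Qed.
End ContinuousIntegrals.

(** * Test functions and the bearing forms *)

Lemma D_in_comb (f df g dg : R -> R) (D : R -> Prop) (a b x : R) :
  D_in f df D x -> D_in g dg D x ->
  D_in (fun x => a * f x + b * g x) (fun x => a * df x + b * dg x) D x.
Proof. intros hf hg. apply Dadd; now apply Dmult_const. Qed.

(** Increments smaller than the distance to both endpoints stay in the interval, so the relative
    derivative is the ordinary one. *)
Lemma D_in_interior (f df : R -> R) (a b x : R) :
  a < x < b -> D_in f df (fun x => a <= x <= b) x -> is_derive f x (df x).
Proof.
  intros hx h. apply is_derive_Reals. intros e he.
  destruct (h e he) as [d [hd hlim]].
  assert (hd' : 0 < Rmin d (Rmin (x - a) (b - x))).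
  { repeat apply Rmin_glb_lt; lra. }
  exists (mkposreal _ hd'). intros k hk hkd. simpl in hkd.
  assert (h1 : Rabs k < d) by (eapply Rlt_le_trans; [exact hkd | apply Rmin_l]).
  assert (h2 : Rabs k < Rmin (x - a) (b - x))
    by (eapply Rlt_le_trans; [exact hkd | apply Rmin_r]).
  assert (h3 : Rabs k < x - a) by (eapply Rlt_le_trans; [exact h2 | apply Rmin_l]).
  assert (h4 : Rabs k < b - x) by (eapply Rlt_le_trans; [exact h2 | apply Rmin_r]).
  apply Rabs_def2 in h3. apply Rabs_def2 in h4.
  specialize (hlim (x + k)). simpl in hlim. unfold Rdist in hlim.
  replace (x + k - x) with k in hlim by ring.
  apply hlim. repeat split; try lra; try assumption.
Qed.

Lemma continuous_on_comb {U : UniformSpace} (D : U -> Prop) (f g : U -> R) (a b : R) :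
  continuous_on D f -> continuous_on D g ->
  continuous_on D (fun x => a * f x + b * g x).
Proof.
  intros hf hg x hx.
  assert (h : forall (c : R) (k : U -> R), continuous_on D k ->
            filterlim (fun x => c * k x) (within D (locally x)) (locally (c * k x))).
  { intros c k hk. eapply filterlim_comp; [now apply hk |].
    apply (filterlim_scal_r (V := R_NormedModule) c (k x)). }
  eapply filterlim_comp_2; [now apply h | now apply h |].
  apply (filterlim_plus (V := R_NormedModule)).
Qed.

Section TestFunctions.
Context {R1 R2 L : R} (hR : R1 < R2) (hL : 0 < L).

Lemma Cn_on_comb (n : nat) (a b : R) : forall u w,
  Cn_on R1 R2 L n u -> Cn_on R1 R2 L n w ->
  Cn_on R1 R2 L n (fun x => a * u x + b * w x).
Proof.
  induction n as [| n IH]; intros u w [hcu hu] [hcw hw].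
  - split; [now apply continuous_on_comb | exact I].
  - split; [now apply continuous_on_comb |].
    destruct hu as [ur [ut [uy [hup [hur [hut huy]]]]]].
    destruct hw as [wr [wt [wy [hwp [hwr [hwt hwy]]]]]].
    exists (fun x => a * ur x + b * wr x), (fun x => a * ut x + b * wt x),
           (fun x => a * uy x + b * wy x).
    split; [| now repeat split; apply IH].
    intros rho theta y hq.
    destruct (hup rho theta y hq) as [h1 [h2 h3]].
    destruct (hwp rho theta y hq) as [h4 [h5 h6]].
    split; [| split].
    + exact (D_in_comb _ _ _ _ _ a b _ h1 h4).
    + apply (is_derive_plus (V := R_NormedModule)); now apply is_derive_scal.
    + exact (D_in_comb _ _ _ _ _ a b _ h3 h6).
Qed.

Lemma Cn_on_zero (n : nat) : Cn_on R1 R2 L n (fun _ => 0).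
Proof.
  induction n as [| n IH]; (split; [intros x hx; apply filterlim_const |]).
  - exact I.
  - exists (fun _ => 0), (fun _ => 0), (fun _ => 0).
    split; [| now repeat split; apply IH].
    intros rho theta y _. split; [| split].
    + apply (Dconst _ 0).
    + apply (is_derive_const (V := R_NormedModule)).
    + apply (Dconst _ 0).
Qed.

Lemma test_function_subspace : subspace (test_function R1 R2 L).
Proof.
  split.
  - split; [| split].
    + intro n. apply Cn_on_zero.
    + reflexivity.
    + intros. apply filter_forall. reflexivity.
  - intros a b u w [hu1 [hu2 hu3]] [hw1 [hw2 hw3]]. split; [| split].
    + intro n. now apply Cn_on_comb.
    + intros rho theta y hq. now rewrite hu2, hw2.
    + intros rho theta y hq hf.
      specialize (hu3 rho theta y hq hf). specialize (hw3 rho theta y hq hf).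
      generalize (filter_and _ _ hu3 hw3). apply filter_imp. simpl.
      intros q [h1 h2]. rewrite h1, h2. ring.
Qed.

(** The ranges differ on purpose: the theta and y derivatives reach rho = R2, where the surface
    integrals need them, while the derivative across that face is only one-sided. *)
Definition partials_inside (v vr vt vy : point -> R) : Prop :=
  continuous_on (Qbar R1 R2 L) v /\
  (continuous_on (Qbar R1 R2 L) vr /\ continuous_on (Qbar R1 R2 L) vt /\
   continuous_on (Qbar R1 R2 L) vy) /\
  (forall rho theta y, R1 < rho < R2 -> 0 <= y <= L ->
     is_derive (fun r => v (r, theta, y)) rho (vr (rho, theta, y))) /\
  (forall rho theta y, R1 <= rho <= R2 -> 0 <= y <= L ->
     is_derive (fun t => v (rho, t, y)) theta (vt (rho, theta, y))) /\
  (forall rho theta y, R1 <= rho <= R2 -> 0 < y < L ->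
     is_derive (fun z => v (rho, theta, z)) y (vy (rho, theta, y))).

Lemma test_function_partials (v : point -> R) : test_function R1 R2 L v ->
  exists vr vt vy, partials_inside v vr vt vy.
Proof.
  intros [hs _]. destruct (hs 1%nat) as [hc [vr [vt [vy [hp [[hr _] [[ht _] [hy _]]]]]]]].
  exists vr, vt, vy. split; [assumption |]. split; [tauto |]. split; [| split].
  - intros rho theta y h1 h2. destruct (hp rho theta y) as [h _]; [split; lra |].
    exact (D_in_interior _ _ _ _ _ h1 h).
  - intros rho theta y h1 h2. now apply hp.
  - intros rho theta y h1 h2. destruct (hp rho theta y) as [_ [_ h]]; [split; lra |].
    exact (D_in_interior _ _ _ _ _ h2 h).
Qed.

Lemma D_rho_comb (u w : point -> R) (a b rho theta y : R) :
  test_function R1 R2 L u -> test_function R1 R2 L w -> R1 < rho < R2 -> 0 < y < L ->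
  D_rho (fun x => a * u x + b * w x) (rho, theta, y)
  = a * D_rho u (rho, theta, y) + b * D_rho w (rho, theta, y).
Proof.
  intros hu hw hr hy.
  destruct (test_function_partials u hu) as [ur [ut [uy [_ [_ [h1 _]]]]]].
  destruct (test_function_partials w hw) as [wr [wt [wy [_ [_ [h2 _]]]]]].
  specialize (h1 rho theta y hr ltac:(lra)). specialize (h2 rho theta y hr ltac:(lra)).
  transitivity (a * ur (rho, theta, y) + b * wr (rho, theta, y)).
  2: { f_equal; f_equal; symmetry; now apply is_derive_unique. }
  apply is_derive_unique.
  apply (is_derive_plus (V := R_NormedModule)); now apply is_derive_scal.
Qed.

Lemma D_theta_comb (u w : point -> R) (a b rho theta y : R) :
  test_function R1 R2 L u -> test_function R1 R2 L w -> R1 <= rho <= R2 -> 0 < y < L ->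
  D_theta (fun x => a * u x + b * w x) (rho, theta, y)
  = a * D_theta u (rho, theta, y) + b * D_theta w (rho, theta, y).
Proof.
  intros hu hw hr hy.
  destruct (test_function_partials u hu) as [ur [ut [uy [_ [_ [_ [h1 _]]]]]]].
  destruct (test_function_partials w hw) as [wr [wt [wy [_ [_ [_ [h2 _]]]]]]].
  specialize (h1 rho theta y hr ltac:(lra)). specialize (h2 rho theta y hr ltac:(lra)).
  transitivity (a * ut (rho, theta, y) + b * wt (rho, theta, y)).
  2: { f_equal; f_equal; symmetry; now apply is_derive_unique. }
  apply is_derive_unique.
  apply (is_derive_plus (V := R_NormedModule)); now apply is_derive_scal.
Qed.

Lemma D_y_comb (u w : point -> R) (a b rho theta y : R) :
  test_function R1 R2 L u -> test_function R1 R2 L w -> R1 <= rho <= R2 -> 0 < y < L ->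
  D_y (fun x => a * u x + b * w x) (rho, theta, y)
  = a * D_y u (rho, theta, y) + b * D_y w (rho, theta, y).
Proof.
  intros hu hw hr hy.
  destruct (test_function_partials u hu) as [ur [ut [uy [_ [_ [_ [_ h1]]]]]]].
  destruct (test_function_partials w hw) as [wr [wt [wy [_ [_ [_ [_ h2]]]]]]].
  specialize (h1 rho theta y hr hy). specialize (h2 rho theta y hr hy).
  transitivity (a * uy (rho, theta, y) + b * wy (rho, theta, y)).
  2: { f_equal; f_equal; symmetry; now apply is_derive_unique. }
  apply is_derive_unique.
  apply (is_derive_plus (V := R_NormedModule)); now apply is_derive_scal.
Qed.

Lemma continuous_inside3_ext (f g : R -> R -> R -> R) :
  (forall rho theta y, R1 < rho < R2 -> 0 < y < L -> f rho theta y = g rho theta y) ->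
  continuous_inside3 R1 R2 L g -> continuous_inside3 R1 R2 L f.
Proof.
  intros h [G [hG eg]]. exists G. split; [assumption |].
  intros rho theta y hr hy. rewrite h by assumption. now apply eg.
Qed.

Lemma continuous_inside2_ext (f g : R -> R -> R) :
  (forall theta y, 0 < y < L -> f theta y = g theta y) ->
  continuous_inside2 L g -> continuous_inside2 L f.
Proof.
  intros h [G [hG eg]]. exists G. split; [assumption |].
  intros theta y hy. rewrite h by assumption. now apply eg.
Qed.

Lemma continuous_inside3_D (v : point -> R) : test_function R1 R2 L v ->
  continuous_inside3 R1 R2 L (fun rho theta y => D_rho v (rho, theta, y)) /\
  continuous_inside3 R1 R2 L (fun rho theta y => D_theta v (rho, theta, y)) /\
  continuous_inside3 R1 R2 L (fun rho theta y => D_y v (rho, theta, y)).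
Proof.
  intro hv.
  destruct (test_function_partials v hv)
    as [vr [vt [vy [_ [[hr [ht hy]] [dr [dt dy]]]]]]].
  split; [| split].
  - eapply continuous_inside3_ext; [| exact (continuous_on_inside3 hR hL vr hr)].
    intros rho theta y h1 h2. apply is_derive_unique. apply dr; lra.
  - eapply continuous_inside3_ext; [| exact (continuous_on_inside3 hR hL vt ht)].
    intros rho theta y h1 h2. apply is_derive_unique. apply dt; lra.
  - eapply continuous_inside3_ext; [| exact (continuous_on_inside3 hR hL vy hy)].
    intros rho theta y h1 h2. apply is_derive_unique. apply dy; lra.
Qed.

Lemma continuous_inside2_D (v : point -> R) : test_function R1 R2 L v ->
  continuous_inside2 L (fun theta y => v (R2, theta, y)) /\
  continuous_inside2 L (fun theta y => D_theta v (R2, theta, y)) /\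
  continuous_inside2 L (fun theta y => D_y v (R2, theta, y)).
Proof.
  intro hv.
  destruct (test_function_partials v hv)
    as [vr [vt [vy [hc [[_ [ht hy]] [_ [dt dy]]]]]]].
  split; [| split].
  - exact (continuous_on_inside2 hR hL v hc).
  - eapply continuous_inside2_ext; [| exact (continuous_on_inside2 hR hL vt ht)].
    intros theta y h. apply is_derive_unique. apply dt; lra.
  - eapply continuous_inside2_ext; [| exact (continuous_on_inside2 hR hL vy hy)].
    intros theta y h. apply is_derive_unique. apply dy; lra.
Qed.

(** * The bilinear form and the energy *)

Lemma volume_integrand_inside (u v : point -> R) : 0 < R1 ->
  test_function R1 R2 L u -> test_function R1 R2 L v ->
  continuous_inside3 R1 R2 L (fun rho theta y =>
    (D_rho u (rho, theta, y) * D_rho v (rho, theta, y)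
     + 1 / rho ^ 2 * (D_theta u (rho, theta, y) * D_theta v (rho, theta, y))
     + D_y u (rho, theta, y) * D_y v (rho, theta, y)) * rho).
Proof.
  intros hR1 hu hv.
  destruct (continuous_inside3_D u hu) as [h1 [h2 h3]].
  destruct (continuous_inside3_D v hv) as [h4 [h5 h6]].
  apply continuous_inside3_mult;
    [apply continuous_inside3_plus; [apply continuous_inside3_plus |] |];
    try (now apply continuous_inside3_mult).
  - apply continuous_inside3_mult; [| now apply continuous_inside3_mult].
    apply (continuous_inside3_rho hR (fun rho => 1 / rho ^ 2)).
    intros x hx. apply (ex_derive_continuous (V := R_NormedModule)).
    auto_derive. nra.
  - apply (continuous_inside3_rho hR (fun rho => rho)). intros x _. apply continuous_id.
Qed.

Lemma surface_integrand_inside (k1 k2 : R) (h : R -> R) (u v : point -> R) :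
  (forall x, continuous h x) ->
  test_function R1 R2 L u -> test_function R1 R2 L v ->
  continuous_inside2 L (fun theta y =>
    h theta ^ 3 * (k1 * (D_theta u (R2, theta, y) * D_theta v (R2, theta, y))
                   + k2 * (D_y u (R2, theta, y) * D_y v (R2, theta, y))) * R2).
Proof.
  intros hh hu hv.
  destruct (continuous_inside2_D u hu) as [_ [h2 h3]].
  destruct (continuous_inside2_D v hv) as [_ [h5 h6]].
  apply continuous_inside2_mult; [| apply continuous_inside2_const].
  apply continuous_inside2_mult.
  - apply (continuous_inside2_theta (fun theta => h theta ^ 3)).
    intro x. apply (continuous_comp h (fun z => z ^ 3)); [apply hh |].
    apply (ex_derive_continuous (V := R_NormedModule)). auto_derive. exact I.
  - apply continuous_inside2_plus;
      (apply continuous_inside2_mult;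
        [apply continuous_inside2_const | now apply continuous_inside2_mult]).
Qed.

Lemma volume_integral_nonneg (v : point -> R) : 0 < R1 -> test_function R1 R2 L v ->
  0 <= int_Q R1 R2 L (fun rho theta y =>
    (D_rho v (rho, theta, y) * D_rho v (rho, theta, y)
     + 1 / rho ^ 2 * (D_theta v (rho, theta, y) * D_theta v (rho, theta, y))
     + D_y v (rho, theta, y) * D_y v (rho, theta, y)) * rho).
Proof.
  intros hR1 hv. apply (int_Q_nonneg hR hL); [now apply volume_integrand_inside |].
  intros rho theta y hr hy.
  assert (h : 0 <= 1 / rho ^ 2).
  { apply Rlt_le, Rdiv_lt_0_compat; [lra | apply pow_lt; lra]. }
  repeat (apply Rle_0_sqr || apply Rmult_le_pos || apply Rplus_le_le_0_compat);
    try assumption; lra.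
Qed.

(** The weight h is left general because the lemma serves twice: with h = 1 for the energy and with
    the film thickness for the bearing form. *)
Lemma bilinear_form_psd (k1 k2 : R) (h : R -> R) : 0 < R1 -> 0 <= k1 -> 0 <= k2 ->
  (forall x, continuous h x) -> (forall x, 0 <= h x) ->
  psd_form (test_function R1 R2 L) (bilinear_form R1 R2 L k1 k2 h).
Proof.
  intros hR1 hk1 hk2 hc hh. split.
  - intros a b u w z hu hw hz. unfold bilinear_form.
    (* Volume and surface terms are regrouped so that linearity of each integral applies
       separately. *)
    match goal with |- _ = a * (?p + ?q) + b * (?r + ?s) =>
      replace (a * (p + q) + b * (r + s)) with ((a * p + b * r) + (a * q + b * s)) by ring
    end.
    f_equal.
    + rewrite <- (int_Q_comb hR hL) by (now apply volume_integrand_inside).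
      apply int_Q_ext; try assumption. intros rho theta y hr hy.
      rewrite D_rho_comb, D_theta_comb, D_y_comb by (assumption || lra). ring.
    + rewrite <- (int_C2_comb hL) by (now apply surface_integrand_inside).
      apply int_C2_ext; try assumption. intros theta y hy.
      rewrite D_theta_comb, D_y_comb by (assumption || lra). ring.
  - intros u w hu hw. unfold bilinear_form. f_equal.
    + apply int_Q_ext; try assumption. intros; ring.
    + apply int_C2_ext; try assumption. intros; ring.
  - intros u hu. unfold bilinear_form. apply Rplus_le_le_0_compat.
    + now apply volume_integral_nonneg.
    + apply (int_C2_nonneg hL); [now apply surface_integrand_inside |].
      intros theta y hy. specialize (hh theta).
      repeat (apply Rle_0_sqr || apply Rmult_le_pos || apply Rplus_le_le_0_compat
              || apply pow_le); try assumption; lra.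
Qed.

(** The volume part carries no weight, so it is compared with s times itself, whence 1 <= s; the
    surface part is compared pointwise. With the constant weight 1 on one side or the other this
    gives coercivity and boundedness. *)
Lemma bilinear_form_diag_le (k1 k2 s : R) (h h' : R -> R) (v : point -> R) :
  0 < R1 -> 0 <= k1 -> 0 <= k2 -> 1 <= s ->
  (forall x, continuous h x) -> (forall x, continuous h' x) ->
  (forall x, h x ^ 3 <= s * h' x ^ 3) -> test_function R1 R2 L v ->
  bilinear_form R1 R2 L k1 k2 h v v <= s * bilinear_form R1 R2 L k1 k2 h' v v.
Proof.
  intros hR1 hk1 hk2 hs hc hc' hh hv. unfold bilinear_form.
  rewrite Rmult_plus_distr_l. apply Rplus_le_compat.
  - match goal with |- ?p <= _ => assert (h0 : 0 <= p) end; [| nra].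
    now apply volume_integral_nonneg.
  - apply (int_C2_le hL); try (now apply surface_integrand_inside).
    intros theta y hy. rewrite <- 2!(Rmult_assoc s).
    apply Rmult_le_compat_r; [lra |]. apply Rmult_le_compat_r; [| apply hh].
    repeat (apply Rle_0_sqr || apply Rmult_le_pos || apply Rplus_le_le_0_compat);
      assumption.
Qed.

Lemma energy_norm_eq (k1 k2 : R) (v : point -> R) :
  energy_norm R1 R2 L k1 k2 v = sqrt (bilinear_form R1 R2 L k1 k2 (fun _ => 1) v v).
Proof.
  unfold energy_norm, bilinear_form. f_equal. f_equal.
  - apply int_Q_ext; try assumption. intros; ring.
  - apply int_C2_ext; try assumption. intros; ring.
Qed.

(** * The load functional and its bound by the energy *)

Lemma load_linear (k3 : R) (h : R -> R) : (forall x, continuous (Derive h) x) ->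
  linear_form (test_function R1 R2 L) (load R2 L k3 h).
Proof.
  intros hh. split. intros a b u w hu hw. unfold load.
  assert (hin : forall v, test_function R1 R2 L v ->
            continuous_inside2 L (fun theta y => k3 * Derive h theta * v (R2, theta, y) * R2)).
  { intros v hv. destruct (continuous_inside2_D v hv) as [h0 _].
    repeat apply continuous_inside2_mult; try apply continuous_inside2_const;
      [now apply continuous_inside2_theta | assumption]. }
  rewrite <- (int_C2_comb hL) by now apply hin.
  apply int_C2_ext; try assumption. intros; ring.
Qed.

(* The primitive is compared through the mean value theorem because g need not be
   differentiable at the endpoints. *)
Lemma RInt_by_parts_vanishing (g dg : R -> R) :
  (forall y, continuous g y) -> (forall y, continuous dg y) ->
  (forall y, 0 < y < L -> is_derive g y (dg y)) -> g 0 = 0 ->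
  RInt g 0 L = RInt (fun y => (L - y) * dg y) 0 L.
Proof.
  intros hg hdg hd h0.
  assert (hk : forall y, continuous (fun y => (L - y) * dg y) y).
  { intro y. apply (continuous_mult (K := R_AbsRing)); [| apply hdg].
    apply (continuous_minus (V := R_NormedModule));
      [apply continuous_const | apply continuous_id]. }
  assert (hI : forall f : R -> R, (forall y, continuous f y) -> forall x,
            is_derive (fun x => RInt f 0 x) x (f x)).
  { intros f hf x.
    apply (is_derive_RInt (V := R_NormedModule) f (fun x => RInt f 0 x) 0 x); [| apply hf].
    apply filter_forall. intro z. apply (RInt_correct (V := R_CompleteNormedModule)).
    now apply ex_RInt_continuous_everywhere. }
  (* The last summand is the boundary term. P has zero derivative inside and P(0) = L g(0) = 0,
     while P(L) is the difference of the two integrals. *)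
  set (P := fun x => RInt g 0 x - RInt (fun y => (L - y) * dg y) 0 x + (L - x) * g x).
  destruct (MVT_gen P 0 L (fun _ => 0)) as [z [_ hz]].
  - intros x hx. rewrite Rmin_left, Rmax_right in hx by lra.
    assert (hl : is_derive (fun x => L - x) x (- 1)) by (auto_derive; [exact I | ring]).
    replace 0 with (g x - (L - x) * dg x + (-1 * g x + (L - x) * dg x)) by ring.
    apply (is_derive_plus (V := R_NormedModule)).
    + apply (is_derive_minus (V := R_NormedModule)); [now apply hI |].
      now apply (hI (fun y => (L - y) * dg y)).
    + apply (is_derive_mult (K := R_AbsRing) (fun x => L - x) g);
        [assumption | now apply hd | intros; apply Rmult_comm].
  - intros x hx. apply continuity_pt_filterlim.
    apply (continuous_plus (V := R_NormedModule)).
    + apply (continuous_minus (V := R_NormedModule));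
        apply (ex_derive_continuous (V := R_NormedModule)).
      * eexists. now apply hI.
      * eexists. now apply (hI (fun y => (L - y) * dg y)).
    + apply (continuous_mult (K := R_AbsRing)); [| apply hg].
      apply (continuous_minus (V := R_NormedModule));
        [apply continuous_const | apply continuous_id].
  - unfold P in hz.
    rewrite !RInt_point, h0 in hz. change (zero : R) with 0 in hz. lra.
Qed.

(** Along the segment, v and its y derivative are replaced by their clamped extensions, since
    integration by parts asks for continuity on the whole line and v is controlled only on
    [Qbar]. *)
Lemma RInt_face_by_parts (v : point -> R) (theta : R) : test_function R1 R2 L v ->
  RInt (fun y => v (R2, theta, y)) 0 L
  = RInt (fun y => (L - y) * D_y v (R2, theta, y)) 0 L.
Proof.
  intro hv.
  destruct (test_function_partials v hv)
    as [vr [vt [vy [hc [[_ [_ hy]] [_ [_ dy]]]]]]].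
  set (cl := fun y => clamp_point (R1 := R1) (R2 := R2) (L := L) (R2, theta, y)).
  assert (hcl : forall y, 0 <= y <= L -> cl y = (R2, theta, y)).
  { intros y h. unfold cl, clamp_point; simpl. now rewrite !clamp_id by lra. }
  assert (hcont : forall w : point -> R, continuous_on (Qbar R1 R2 L) w ->
            forall y : R, continuous (fun y => w (cl y)) y).
  { intros w hw y.
    exact (continuous_slice3 (fun p => w (clamp_point p)) R2 theta
             (continuous_clamp_extension hR hL w hw) y). }
  transitivity (RInt (fun y => v (cl y)) 0 L).
  { apply RInt_ext. intros y h. rewrite Rmin_left, Rmax_right in h by lra.
    now rewrite hcl by lra. }
  transitivity (RInt (fun y => (L - y) * vy (cl y)) 0 L).
  2: { apply RInt_ext. intros y h. rewrite Rmin_left, Rmax_right in h by lra.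
       rewrite hcl by lra. f_equal. symmetry. apply is_derive_unique. apply dy; lra. }
  apply (RInt_by_parts_vanishing (fun y => v (cl y)) (fun y => vy (cl y))).
  - now apply hcont.
  - now apply hcont.
  - intros y h. rewrite hcl by lra.
    apply (is_derive_ext_loc (fun y => v (R2, theta, y))); [| apply dy; lra].
    apply (locally_interval _ y 0 L); [apply h | apply h |].
    intros z h1 h2. simpl in h1, h2. now rewrite hcl by lra.
  - rewrite hcl by lra. destruct hv as [_ [_ hv]].
    assert (hq : Qbar R1 R2 L (R2, theta, 0)) by (split; lra).
    assert (h := hv R2 theta 0 hq ltac:(now (right; left))).
    apply locally_singleton in h. now apply h.
Qed.

(** After integration by parts the load is the integral of K v_y, at most half the integral of K^2
    plus half that of v_y^2. The surface energy contains k2 R2 v_y^2, which gives b = 1 / (2 k2 R2);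
    the K^2 term does not depend on v and is a. *)
Lemma load_bounded (k1 k2 k3 : R) (h : R -> R) : 0 < R1 -> 0 <= k1 -> 0 < k2 ->
  (forall x, continuous (Derive h) x) ->
  exists a b : R, 0 <= b /\ forall v, test_function R1 R2 L v ->
    load R2 L k3 h v <= a + b * bilinear_form R1 R2 L k1 k2 (fun _ => 1) v v.
Proof.
  intros hR1 hk1 hk2 hh.
  set (K := fun theta y => k3 * Derive h theta * R2 * (L - y)).
  exists (1 / 2 * int_C2 L (fun theta y => K theta y * K theta y)), (1 / (2 * (k2 * R2))).
  assert (hkR : 0 < k2 * R2) by nra.
  split; [apply Rlt_le, Rdiv_lt_0_compat; lra |].
  intros v hv.
  destruct (continuous_inside2_D v hv) as [h0 [h1 h2]].
  assert (hK : continuous_inside2 L K).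
  { apply continuous_inside2_mult.
    - repeat apply continuous_inside2_mult; try apply continuous_inside2_const.
      now apply continuous_inside2_theta.
    - apply (continuous_inside2_y (fun y => L - y)). intro y.
      apply (continuous_minus (V := R_NormedModule));
        [apply continuous_const | apply continuous_id]. }
  assert (e : load R2 L k3 h v = int_C2 L (fun theta y => K theta y * D_y v (R2, theta, y))).
  { unfold load, int_C2. apply RInt_ext. intros theta _.
    (* This factor depends on theta only, so it leaves the inner integral before integration by
       parts in y and returns afterwards. *)
    assert (hpull : forall f : R -> R, ex_RInt f 0 L ->
              RInt (fun y => (k3 * Derive h theta * R2) * f y) 0 L
              = (k3 * Derive h theta * R2) * RInt f 0 L).
    { intros f hf. now apply (RInt_scal (V := R_CompleteNormedModule)). }
    assert (hsl : forall f, continuous_inside2 L f -> ex_RInt (f theta) 0 L).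
    { intros f [F [hF ef]]. apply (ex_RInt_ext (fun y => F (theta, y))).
      - intros y hy. rewrite Rmin_left, Rmax_right in hy by lra. symmetry. now apply ef.
      - apply ex_RInt_continuous_everywhere. now apply continuous_slice2. }
    transitivity (RInt (fun y => (k3 * Derive h theta * R2) * v (R2, theta, y)) 0 L).
    { apply RInt_ext. intros; simpl; ring. }
    rewrite hpull by (apply (hsl (fun theta y => v (R2, theta, y))); assumption).
    rewrite RInt_face_by_parts by assumption.
    rewrite <- hpull.
    - apply RInt_ext. intros; unfold K; simpl; ring.
    - apply (hsl (fun theta y => (L - y) * D_y v (R2, theta, y))).
      apply continuous_inside2_mult; [| assumption].
      apply (continuous_inside2_y (fun y => L - y)). intro y.
      apply (continuous_minus (V := R_NormedModule));
        [apply continuous_const | apply continuous_id]. }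
  rewrite e. clear e.
  assert (hKK := continuous_inside2_mult _ _ hK hK).
  assert (hDD := continuous_inside2_mult _ _ h2 h2).
  apply Rle_trans with (1 * int_C2 L (fun theta y =>
    1 / 2 * (K theta y * K theta y)
    + 1 / 2 * (D_y v (R2, theta, y) * D_y v (R2, theta, y)))).
  { apply (int_C2_le hL).
    - now apply continuous_inside2_mult.
    - apply continuous_inside2_plus;
        (apply continuous_inside2_mult; [apply continuous_inside2_const | assumption]).
    - intros theta y _.
      assert (hsq := pow2_ge_0 (K theta y - D_y v (R2, theta, y))). lra. }
  rewrite Rmult_1_l, (int_C2_comb hL) by assumption.
  apply Rplus_le_compat_l.
  assert (hs : int_C2 L (fun theta y => D_y v (R2, theta, y) * D_y v (R2, theta, y))
          <= 1 / (k2 * R2) * bilinear_form R1 R2 L k1 k2 (fun _ => 1) v v).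
  { unfold bilinear_form. rewrite Rmult_plus_distr_l.
    (* The volume energy is nonnegative and is discarded; the surface energy alone controls v_y. *)
    match goal with |- ?l <= ?p + ?q => assert (hp : 0 <= p); [| assert (hq : l <= q)] end;
      [| | lra].
    - apply Rmult_le_pos; [apply Rlt_le, Rdiv_lt_0_compat; lra |].
      now apply volume_integral_nonneg.
    - apply (int_C2_le hL); [assumption | |].
      + apply surface_integrand_inside; try assumption. intro; apply continuous_const.
      + intros theta y _.
        set (p := D_y v (R2, theta, y)). set (q := D_theta v (R2, theta, y)).
        replace (1 / (k2 * R2) * (1 ^ 3 * (k1 * (q * q) + k2 * (p * p)) * R2))
          with (p * p + k1 / k2 * (q * q)) by (field; lra).
        assert (hpos : 0 <= k1 / k2 * (q * q)); [| lra].
        apply Rmult_le_pos; [now apply Rle_mult_inv_pos | apply Rle_0_sqr]. }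
  replace (1 / (2 * (k2 * R2))) with (1 / 2 * (1 / (k2 * R2))) by (field; lra).
  lra.
Qed.
End TestFunctions.

(** * The film thickness and the bearing problem *)

Lemma film_thickness_derive (c eps theta : R) :
  is_derive (film_thickness c eps) theta (c * (eps * - sin theta)).
Proof. unfold film_thickness. auto_derive; [exact I | ring]. Qed.

Lemma film_thickness_bounds (c eps theta : R) : 0 < c -> 0 < eps -> eps < 1 ->
  c * (1 - eps) <= film_thickness c eps theta <= c * (1 + eps).
Proof.
  intros hc h0 h1. unfold film_thickness.
  destruct (COS_bound theta) as [h2 h3].
  split; apply Rmult_le_compat_l; nra.
Qed.

Lemma continuous_Derive_film_thickness (c eps x : R) :
  continuous (Derive (film_thickness c eps)) x.
Proof.
  apply continuous_ext with (fun theta => c * (eps * - sin theta)).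
  - intro theta. symmetry. apply is_derive_unique, film_thickness_derive.
  - apply (ex_derive_continuous (V := R_NormedModule)). auto_derive. exact I.
Qed.

Theorem mainTheorem2 (R1 R2 L c eps Phi U mu : R)
  (hR1 : 0 < R1) (hR12 : R1 < R2) (hL : 0 < L)
  (hc : 0 < c) (heps0 : 0 < eps) (heps1 : eps < 1)
  (hPhi : 0 < Phi) (hU : 0 < U) (hmu : 0 < mu) :
  let k1 := coef1 c Phi R2 in
  let k2 := coef2 c Phi L in
  let k3 := coef3 U mu Phi R2 in
  let h := film_thickness c eps in
  exists! u : H1_00 R1 R2 L k1 k2,
    forall v : H1_00 R1 R2 L k1 k2,
      extend2 (bilinear_form R1 R2 L k1 k2 h) u v = extend1 (load R2 L k3 h) v.
Proof.
  intros k1 k2 k3 h.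
  assert (hk1 : 0 < k1).
  { unfold k1, coef1. apply Rdiv_lt_0_compat; [now apply pow_lt |].
    assert (0 < R2 ^ 2) by (apply pow_lt; lra). nra. }
  assert (hk2 : 0 < k2).
  { unfold k2, coef2. apply Rdiv_lt_0_compat; [now apply pow_lt |].
    assert (0 < L ^ 2) by now apply pow_lt. nra. }
  assert (hhc : forall x, continuous h x).
  { intro x. apply (ex_derive_continuous (V := R_NormedModule)).
    eexists. apply film_thickness_derive. }
  assert (hcst : forall x : R, continuous (fun _ : R => 1) x)
    by (intro; apply continuous_const).
  assert (hb : forall x, c * (1 - eps) <= h x <= c * (1 + eps))
    by (intro; now apply film_thickness_bounds).
  (* As eps < 1 the film never closes, so h^3 stays above a positive constant, which yields
     coercivity of the surface part. *)
  set (lo := (c * (1 - eps)) ^ 3).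
  assert (hlo : 0 < lo) by (apply pow_lt; nra).
  assert (hh3 : forall x, lo <= h x ^ 3 <= (c * (1 + eps)) ^ 3).
  { intro x. destruct (hb x) as [h1 h2].
    assert (hpos : 0 < c * (1 - eps)) by nra.
    split; apply pow_incr; lra. }
  destruct (load_bounded hR12 hL k1 k2 k3 h hR1 (Rlt_le _ _ hk1) hk2
              (continuous_Derive_film_thickness c eps)) as [a [b [hb0 hload]]].
  (* The energy is the form with weight 1. The maxima with 1 in [al] and [M] account for the
     unweighted volume integral, which forces both comparison factors to be at least 1. *)
  apply (completion_riesz (E := bilinear_form R1 R2 L k1 k2 (fun _ => 1))
           (al := / Rmax 1 (/ lo)) (M := Rmax 1 ((c * (1 + eps)) ^ 3)) (a := a) (b := b)).
  - now apply test_function_subspace.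
  - apply bilinear_form_psd; try assumption; intros; lra.
  - intros u _. now apply energy_norm_eq.
  - apply bilinear_form_psd; try assumption; try lra.
    intro x. specialize (hb x). nra.
  - apply load_linear; [assumption | assumption |]. apply continuous_Derive_film_thickness.
  - apply Rinv_0_lt_compat. apply Rlt_le_trans with 1; [lra | apply Rmax_l].
  - intros u hu.
    assert (hm : 1 <= Rmax 1 (/ lo)) by apply Rmax_l.
    (* Coercivity is rewritten as E <= s B with s = max(1, 1 / lo); pointwise this reads 1 = (1 /
       lo) lo <= s h^3. *)
    apply Rmult_le_reg_l with (Rmax 1 (/ lo)); [lra |].
    rewrite <- Rmult_assoc, Rinv_r, Rmult_1_l by lra.
    apply bilinear_form_diag_le; try assumption; try lra.
    intro x. destruct (hh3 x) as [h1 _].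
    apply Rle_trans with (/ lo * lo); [rewrite Rinv_l; lra |].
    apply Rmult_le_compat; try lra; [apply Rlt_le; now apply Rinv_0_lt_compat | apply Rmax_r].
  - apply Rle_trans with 1; [lra | apply Rmax_l].
  - intros u hu. apply bilinear_form_diag_le; try assumption; try lra; [apply Rmax_l |].
    intro x. destruct (hh3 x) as [_ h2].
    rewrite pow1, Rmult_1_r. apply Rle_trans with (1 := h2). apply Rmax_r.
  - assumption.
  - assumption.
Qed.
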